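(* Let $n\ge 1$ and let $\mu$ be a Radon measure on the Heisenberg group $\mathbb{H}^n$ such that the Heisenberg Riesz transform $R_\mu$ is bounded on $L^2(\mu)$ with norm $C_1$, and such that $\mu(F)=0$ for every Borel set $F\subset\mathbb{H}^n$ with $\dim_H(F)\le 2$. Then there exists a constant $C_2$, depending only on $n$ and $C_1$, such that for all $x\in\mathbb{H}^n$ and $r>0$, $$\mu(B(x,r))\le C_2\, r^{2n+1}.$$
   Context: The Heisenberg group $\mathbb{H}^n$ is $\mathbb{R}^{2n}\times\mathbb{R}$ with points $p=(z,t)$, $z=(x_1,\dots,x_n,y_1,\dots,y_n)\in\mathbb{R}^{2n}$, $t\in\mathbb{R}$, and group law $$(z,t)\cdot(z',t')=\Big(z+z',\,t+t'+\tfrac12\sum_{i=1}^n(x_iy_i'-y_ix_i')\Big),$$ identity $(0,0)$ and inverse $(z,t)^{-1}=(-z,-t)$. Korányi metric: $d(p,q)=\|q^{-1}\cdot p\|_{\mathbb{H}}$, where $\|(z,t)\|_{\mathbb{H}}^4=|z|^4+16t^2$ and $|z|$ is the Euclidean norm. $B(p,r)=\{q: d(p,q)\le r\}$. Hausdorff dimension $\dim_H$ is taken with respect to $d$. Riesz kernel: $K=\nabla_{\mathbb{H}}G$ is the horizontal gradient of the fundamental solution $G(p)=c_n\|p\|_{\mathbb{H}}^{-2n}$ of the Heisenberg sub-Laplacian, with the constant normalized so that, for $(z,t)\ne(0,0)$, $K(z,t)\in\mathbb{R}^{2n}$ has components $$K_i(z,t)=n\,\frac{-2x_i|z|^2+8y_it}{\|(z,t)\|_{\mathbb{H}}^{2n+4}},\qquad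 K_{n+i}(z,t)=n\,\frac{-2y_i|z|^2-8x_it}{\|(z,t)\|_{\mathbb{H}}^{2n+4}},\qquad 1\le i\le n.$$ For $\delta>0$ the truncated Riesz transform is $$R_{\mu,\delta}f(p)=\int_{\mathbb{H}^n\setminus B(p,\delta)}K(q^{-1}\cdot p)f(q)\,d\mu(q).$$ ''$R_\mu$ is bounded on $L^2(\mu)$ with norm $C_1$'' means that the operators $R_{\mu,\delta}$ are bounded on $L^2(\mu)$ uniformly in $\delta>0$, i.e. $\|R_{\mu,\delta}f\|_{L^2(\mu)}\le C_1\|f\|_{L^2(\mu)}$ for all $f\in L^2(\mu)$ and all $\delta>0$. *)

(* Defs.v *)
From HB Require Import structures.
From mathcomp Require Import all_boot all_order all_algebra.
From mathcomp Require Import all_classical all_reals all_analysis.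

Set Implicit Arguments.
Unset Strict Implicit.
Unset Printing Implicit Defensive.
Import Order.TTheory GRing.Theory Num.Theory.
Import numFieldNormedType.Exports.
Local Open Scope classical_set_scope.
Local Open Scope ring_scope.

Section HausdorffDimension.
Context {R : realType} {T : Type}.
Variable d : T -> T -> R.

(* The supremum over the empty set is -oo: ediam set0 = -oo. *)
Definition ediam (E : set T) : \bar R :=
  ereal_sup [set (d xy.1 xy.2)%:E | xy in E `*` E].

(* diam(E)^s with the usual conventions 0^0 = 1 and diam(set0)^s = 0, so that
   the measure of dimension 0 is the counting measure. *)
Definition diam_pow (s : R) (E : set T) : \bar R :=
  if E == set0 then 0%E else (ediam E `^ s)%E.

Definition hausdorff_premeasure (s delta : R) (A : set T) : \bar R :=
  ereal_inf [set (\sum_(0 <= i <oo) diam_pow s (E i))%E | E in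
    [set E : (set T)^nat | A `<=` \bigcup_i E i /\
                           forall i, (ediam (E i) <= delta%:E)%E]].

Definition hausdorff_measure (s : R) (A : set T) : \bar R :=
  ereal_sup [set hausdorff_premeasure s delta A
            | delta in [set delta : R | 0 < delta]].

Definition hausdorff_dim (A : set T) : \bar R :=
  ereal_inf [set s%:E | s in [set s : R | 0 <= s /\
                                          hausdorff_measure s A = 0%E]].

End HausdorffDimension.

Definition enorm {R : realType} {m : nat} (z : 'rV[R]_m) : R :=
  Num.sqrt (\sum_(i < m) z 0 i ^+ 2).

(* The group law never equips this type: as a library type it is the additive
   topological space R^(2n) x R.  The Koranyi metric below induces the same
   topology, so open, compact and Borel sets are the intended ones. *)
Notation heis R n := ('rV[R]_(n + n) * R)%type.

Notation heis_borel R n :=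
  (g_sigma_algebraType (open : set (set (heis R n)))).

Section Heisenberg.
Context {R : realType} {n : nat}.
Implicit Types p q : heis R n.

Definition hx p (i : 'I_n) : R := p.1 0 (lshift n i).
Definition hy p (i : 'I_n) : R := p.1 0 (rshift n i).

Definition hmul p q : heis R n :=
  (p.1 + q.1,
   p.2 + q.2 + 2^-1 * \sum_(i < n) (hx p i * hy q i - hy p i * hx q i)).

Definition hinv p : heis R n := (- p.1, - p.2).

Definition knorm p : R := (enorm p.1 ^+ 4 + 16 * p.2 ^+ 2) `^ 4^-1.

Definition hdist p q : R := knorm (hmul (hinv q) p).

Definition hball p (r : R) : set (heis R n) := [set q | hdist p q <= r].

Definition riesz_kernel p : 'rV[R]_(n + n) :=
  \row_(j < n + n)
    match fintype.split j with
    | inl i => n%:R * ((- 2 * hx p i * enorm p.1 ^+ 2 + 8 * hy p i * p.2)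
                       / knorm p ^+ (2 * n + 4))
    | inr i => n%:R * ((- 2 * hy p i * enorm p.1 ^+ 2 - 8 * hx p i * p.2)
                       / knorm p ^+ (2 * n + 4))
    end.

Variable mu : {measure set (heis_borel R n) -> \bar R}.

Definition radon : Prop :=
  [/\ forall K : set (heis R n), compact K -> (mu K < +oo)%E,
      forall U : set (heis R n), open U ->
        mu U = ereal_sup [set mu K | K in
                 [set K : set (heis R n) | compact K /\ K `<=` U]]
    & forall A : set (heis_borel R n), measurable A ->
        mu A = ereal_inf [set mu U | U in
                 [set U : set (heis R n) | open U /\ A `<=` U]]].

Definition riesz_trunc (delta : R) (f : heis R n -> R) p : 'rV[R]_(n + n) :=
  \row_(j < n + n)
    \int[mu]_(q in ~` hball p delta) (riesz_kernel (hmul (hinv q) p) 0 j * f q).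

Definition memL2 (f : heis_borel R n -> R) : Prop :=
  measurable_fun setT f /\ finite_norm mu 2%:E f.

(* The library integral is total, a real-valued integral that does not exist
   being 0.  No convergence is required here: when the truncated integrals
   converge absolutely for mu-almost every p, which is implicit when they
   define operators on L^2(mu), this is the usual notion, so the measures
   satisfying it include all those for which R_mu is bounded in the usual
   sense. *)
Definition riesz_bounded (C : R) : Prop :=
  forall delta : R, 0 < delta -> forall f : heis R n -> R, memL2 f ->
    (Lnorm mu 2%:E (fun p => (enorm (riesz_trunc delta f p))%:E)
       <= C%:E * Lnorm mu 2%:E (EFin \o f))%E.

End Heisenberg.

(* Main.v *)
Require Import Defs.
From mathcomp Require Import all_boot all_order all_algebra.
From mathcomp Require Import all_classical all_reals all_analysis.
From mathcomp Require Import measurable_realfun zify ring lra.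
Set Implicit Arguments.
Unset Strict Implicit.
Unset Printing Implicit Defensive.
Import Order.TTheory GRing.Theory Num.Theory.
Import numFieldNormedType.Exports.
Local Open Scope classical_set_scope.
Local Open Scope ring_scope.

(** Write D = 2n+1 and call mu(B) / r^D the density of a ball B of radius r.
    The kernel satisfies
    |K(z,t)| = 2n |z| / ||(z,t)||^(2n+2), so K vanishes exactly on the vertical
    axis, which has Hausdorff dimension 2.  A measure of very high density is
    therefore only prevented from concentrating near vertical lines by the
    hypothesis on sets of dimension at most 2.

    One scale.  Let B have radius r and density at least Theta, and let
    eta = 2^(-k).  Cut B into boundedly many (in terms of k) pieces so small
    that on one of them, A, carrying a fixed fraction of mu(B), the vectors
    K(q^-1 p), q in A, have a common component of constant sign and size at
    least c eta^3 r^(-D), for each p in B lying outside the vertical tube of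
    width eta r around A ([riesz_kernel_sign]).  Testing the L^2 bound on the
    indicator of A shows that the part of B outside the tube has mass at most
    C(k) r^D / Theta, which is small compared with mu(B) when Theta is large
    ([mass_off_tube]).  The tube inside B is covered by (n+2) 4^k balls of
    radius eta r ([tube_cover]): the number of balls is that of a vertical
    line, a set of dimension 2.

    All scales.  Starting from a ball of radius r, perform this step with
    k = 2j+1 at generation j, so that the radii are r 2^(-j^2), and keep only
    the balls whose mass exceeds a threshold ([heavy_mass]).  The thresholds
    are chosen so that the discarded light balls carry a geometrically small
    part of r^D; the corresponding densities grow super-exponentially in j and
    beat the constants C(2j+1) of the one-scale estimate.  If the initial
    density exceeds a constant depending only on n and C1, the total loss is
    less than the initial mass ([generation_loss]), so the set of points that
    survive in all generations has positive measure.  It is covered, at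
    generation j, by (n+2)^j 4^(j^2) balls of radius r 2^(-j^2), hence it has
    dimension at most 2 ([fast_cover_dim_le2]), a contradiction.

    Koranyi balls are replaced throughout by comparable boxes, whose defining
    inequalities are polynomial. *)

(** * Boxes and the kernel in coordinates *)

(** A box of radius r has Koranyi diameter at most [box_diam R n * r]. *)
Definition box_diam (R : realType) (n : nat) : R := 8 * (n%:R + 2).

Section Geometry.
Context {R : realType} {n : nat}.
Implicit Types p q c x w : heis R n.
Implicit Types a b : 'rV[R]_(n + n).

(** The standard symplectic form on the horizontal layer. *)
Definition omega a b : R :=
  \sum_(i < n) (a 0 (lshift n i) * b 0 (rshift n i)
                - a 0 (rshift n i) * b 0 (lshift n i)).

(** The vertical coordinate of p in the chart centred at c. *)
Definition vert c p : R := (hmul (hinv c) p).2.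

(** A left translate of a parabolic box: it is comparable to a Koranyi ball
    of radius r, but is cut out by polynomial inequalities. *)
Definition box c (r : R) : set (heis R n) :=
  [set p : heis R n |
    (forall j, `|p.1 0 j - c.1 0 j| <= r) /\ `|vert c p| <= r ^+ 2].

Lemma vertE c p : vert c p = p.2 - c.2 - 2^-1 * omega c.1 p.1.
Proof.
rewrite /vert /hmul /hinv /omega /hx /hy /=.
have -> : \sum_(i < n) ((- c.1) 0 (lshift n i) * p.1 0 (rshift n i) -
             (- c.1) 0 (rshift n i) * p.1 0 (lshift n i))
   = - \sum_(i < n) (c.1 0 (lshift n i) * p.1 0 (rshift n i) -
             c.1 0 (rshift n i) * p.1 0 (lshift n i)).
  by rewrite -sumrN; apply: eq_bigr => i _; rewrite !mxE; ring.
by ring.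
Qed.

(** Change of chart: all comparisons between boxes and between kernel values
    with different base points go through this identity. *)
Lemma vert_cocycle x q p :
  vert q p = vert x p - vert x q - 2^-1 * omega (q.1 - x.1) (p.1 - x.1).
Proof.
rewrite !vertE.
have -> : omega (q.1 - x.1) (p.1 - x.1)
   = omega q.1 p.1 + omega x.1 q.1 - omega x.1 p.1.
  rewrite /omega -big_split /= -sumrB; apply: eq_bigr => i _.
  by rewrite !mxE; ring.
by ring.
Qed.

Lemma omega_le a b (s t : R) : (forall j, `|a 0 j| <= s) ->
  (forall j, `|b 0 j| <= t) -> `|omega a b| <= 2 * n%:R * (s * t).
Proof.
move=> ha hb; rewrite /omega.
apply: (le_trans (ler_norm_sum _ _ _)).
apply: (@le_trans _ _ (\sum_(i < n) (2 * (s * t)))); last first.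
  by rewrite sumr_const card_ord -mulr_natr; lra.
apply: ler_sum => i _; apply: (le_trans (ler_normB _ _)); rewrite !normrM.
have h j k : `|a 0 j| * `|b 0 k| <= s * t by apply: ler_pM.
by have := h (lshift n i) (rshift n i); have := h (rshift n i) (lshift n i);
  lra.
Qed.

Lemma vert_le_box x r q p : box x r q -> box x r p ->
  `|vert q p| <= (n%:R + 2) * r ^+ 2.
Proof.
move=> [q1 q2] [p1 p2]; rewrite (vert_cocycle x).
have : `|omega (q.1 - x.1) (p.1 - x.1)| <= 2 * n%:R * (r * r).
  by apply: omega_le => j; rewrite !mxE.
set o := omega _ _ => ho.
have h1 := ler_normB (vert x p - vert x q) (2^-1 * o).
have h2 := ler_normB (vert x p) (vert x q).
have h3 : `|2^-1 * o| = 2^-1 * `|o| by rewrite normrM ger0_norm.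
by move: ho p2 q2 h1 h2; rewrite h3 expr2; lra.
Qed.

Lemma diff_le_box x r q p : box x r q -> box x r p ->
  forall j, `|p.1 0 j - q.1 0 j| <= 2 * r.
Proof.
move=> [q1 _] [p1 _] j.
rewrite (_ : p.1 0 j - q.1 0 j = (p.1 0 j - x.1 0 j) - (q.1 0 j - x.1 0 j));
  last by ring.
by apply: (le_trans (ler_normB _ _)); have := q1 j; have := p1 j; lra.
Qed.

Lemma enorm_sqr m (z : 'rV[R]_m) : enorm z ^+ 2 = \sum_(j < m) z 0 j ^+ 2.
Proof. by rewrite sqr_sqrtr// sumr_ge0// => j _; rewrite sqr_ge0. Qed.

Lemma enorm_ge0 m (z : 'rV[R]_m) : 0 <= enorm z.
Proof. exact: sqrtr_ge0. Qed.

Lemma coord_le_enorm m (z : 'rV[R]_m) j : `|z 0 j| <= enorm z.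
Proof.
rewrite -(@ler_pXn2r _ 2) ?nnegrE ?enorm_ge0// enorm_sqr real_normK ?num_real//.
by rewrite (bigD1 j)//= lerDl sumr_ge0// => i _; rewrite sqr_ge0.
Qed.

Lemma enorm_sqr_le m (z : 'rV[R]_m) (s : R) : (forall j, `|z 0 j| <= s) ->
  enorm z ^+ 2 <= m%:R * s ^+ 2.
Proof.
move=> hz; rewrite enorm_sqr.
apply: (@le_trans _ _ (\sum_(j < m) s ^+ 2)); last first.
  by rewrite sumr_const card_ord mulr_natl.
apply: ler_sum => j _.
by rewrite -[z 0 j ^+ 2]real_normK ?num_real// lerXn2r ?nnegrE// (le_trans _
  (hz j)).
Qed.

Lemma knorm_ge0 p : 0 <= knorm p.
Proof. exact: powR_ge0. Qed.

Lemma knorm4 p : knorm p ^+ 4 = enorm p.1 ^+ 4 + 16 * p.2 ^+ 2.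
Proof.
rewrite -powR_mulrn ?knorm_ge0// /knorm -powRrM mulVf ?powRr1//.
by apply: addr_ge0; [exact: exprn_ge0 (enorm_ge0 _)|rewrite mulr_ge0 ?sqr_ge0].
Qed.

Lemma knorm_le p (s : R) : 0 <= s -> (knorm p <= s) = (knorm p ^+ 4 <= s ^+ 4).
Proof. by move=> s0; rewrite ler_pXn2r// nnegrE ?knorm_ge0. Qed.

Lemma coord_le_knorm p j : `|p.1 0 j| <= knorm p.
Proof.
apply: (le_trans (coord_le_enorm _ _)).
rewrite -(@ler_pXn2r _ 4) ?nnegrE ?enorm_ge0 ?knorm_ge0//.
by rewrite knorm4 lerDl mulr_ge0// sqr_ge0.
Qed.

Lemma vert_le_knorm p : `|p.2| <= knorm p ^+ 2.
Proof.
rewrite -(@ler_pXn2r _ 2) ?nnegrE ?exprn_ge0 ?knorm_ge0//.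
rewrite -exprM knorm4 real_normK ?num_real//.
have : 0 <= enorm p.1 ^+ 4 by rewrite exprn_ge0 ?enorm_ge0.
by have := sqr_ge0 p.2; lra.
Qed.

Definition hdiff q p : heis R n := hmul (hinv q) p.

Lemma hdiff1 q p j : (hdiff q p).1 0 j = p.1 0 j - q.1 0 j.
Proof. by rewrite /hdiff /hmul /hinv /= !mxE addrC. Qed.

Lemma hdiff2 q p : (hdiff q p).2 = vert q p. Proof. by []. Qed.

Lemma omega_anti a b : omega a b = - omega b a.
Proof. by rewrite /omega -sumrN; apply: eq_bigr => i _; ring. Qed.

Lemma vert_anti q p : vert q p = - vert p q.
Proof. by rewrite !vertE omega_anti; ring. Qed.

Lemma hball_sub_box x r : hball x r `<=` box x r.
Proof.
move=> p /= hp; have r0 : 0 <= r by apply: le_trans hp; exact: knorm_ge0.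
split=> [j|].
  by rewrite distrC -hdiff1; apply: le_trans hp; exact: coord_le_knorm.
rewrite vert_anti normrN -hdiff2; apply: (le_trans (vert_le_knorm _)).
by rewrite lerXn2r ?nnegrE ?knorm_ge0.
Qed.

Lemma box_diam_gt0 : 0 < box_diam R n. Proof. by rewrite /box_diam;
  have : 0 <= n%:R :> R by []; lra. Qed.

Lemma hdist_le_box x r q p : 0 <= r -> box x r q -> box x r p ->
  hdist p q <= box_diam R n * r.
Proof.
move=> r0 hq hp; have Cr0 : 0 <= box_diam R n * r by rewrite mulr_ge0// ltW//
  box_diam_gt0.
rewrite /hdist knorm_le// knorm4.
have h2 := vert_le_box hq hp.
have h1 : forall j, `|(hdiff q p).1 0 j| <= 2 * r.
  by move=> j; rewrite hdiff1; exact: diff_le_box hq hp j.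
have {}h1 := enorm_sqr_le h1.
rewrite -/(hdiff q p) hdiff2.
have N0 : 0 <= n%:R :> R by [].
have e2 : vert q p ^+ 2 <= ((n%:R + 2) * r ^+ 2) ^+ 2.
  by rewrite -[X in X <= _]real_normK ?num_real// lerXn2r ?nnegrE// (le_trans _
    h2).
have e1 : enorm (hdiff q p).1 ^+ 4 <= ((n + n)%:R * (2 * r) ^+ 2) ^+ 2.
  rewrite (exprM _ 2 2) lerXn2r ?nnegrE ?sqr_ge0//.
  by rewrite (le_trans _ h1)// sqr_ge0.
have -> : (box_diam R n * r) ^+ 4 = 4096 * (n%:R + 2) ^+ 4 * r ^+ 4 by rewrite
  /box_diam; ring.
have e1' : ((n + n)%:R * (2 * r) ^+ 2) ^+ 2 = 64 * n%:R ^+ 2 * r ^+ 4.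
  by rewrite natrD; ring.
have e2' : ((n%:R + 2) * r ^+ 2) ^+ 2 = (n%:R + 2) ^+ 2 * r ^+ 4 by ring.
have e3 : 64 * n%:R ^+ 2 + 16 * (n%:R + 2) ^+ 2 <= 4096 * (n%:R + 2) ^+ 4 :> R.
  set N : R := n%:R in N0 *.
  have : 64 * N ^+ 2 <= 64 * (N + 2) ^+ 2 by nra.
  have : 1 <= (N + 2) ^+ 2 by nra.
  by move: ((N + 2) ^+ 2) (exprM (N + 2) 2 2) => M /= ->; nra.
have := ler_wpM2r (exprn_ge0 4 r0) e3.
by move: e1 e2; rewrite e1' e2'; lra.
Qed.

(** The polynomial numerator of the kernel, of degree 3 under the dilations. *)
Definition knum w (j : 'I_(n + n)) : R :=
  match fintype.split j with
  | inl i => - 2 * hx w i * enorm w.1 ^+ 2 + 8 * hy w i * w.2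
  | inr i => - 2 * hy w i * enorm w.1 ^+ 2 - 8 * hx w i * w.2
  end.

Lemma riesz_kernelE w j :
  riesz_kernel w 0 j = n%:R * (knum w j / knorm w ^+ (2 * n + 4)).
Proof. by rewrite /riesz_kernel mxE /knum; case: fintype.split. Qed.

Lemma normM_le (u v s t : R) : `|u| <= s -> `|v| <= t -> `|u * v| <= s * t.
Proof. by move=> us vt; rewrite normrM; apply: ler_pM. Qed.

Lemma normM_diff (u u0 v v0 s s' t t' : R) : `|u - u0| <= s' -> `|v| <= t ->
  `|u0| <= s -> `|v - v0| <= t' -> `|u * v - u0 * v0| <= s' * t + s * t'.
Proof.
move=> h1 h2 h3 h4.
rewrite (_ : u * v - u0 * v0 = (u - u0) * v + u0 * (v - v0)); last by ring.
by apply: (le_trans (ler_normD _ _)); apply: lerD; exact: normM_le.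
Qed.

(** Each monomial of [knum] is a product of two factors of dilation weights 1
    and 2, each perturbed by a relative amount of order eps. *)
Lemma knum_diff w w0 (r eps : R) : 0 <= r -> 0 <= eps ->
  (forall j, `|w.1 0 j| <= 2 * r) -> (forall j, `|w0.1 0 j| <= 2 * r) ->
  `|w.2| <= (n%:R + 2) * r ^+ 2 -> 
  (forall j, `|w.1 0 j - w0.1 0 j| <= eps * r) ->
  `|w.2 - w0.2| <= (n%:R + 1) * eps * r ^+ 2 ->
  forall j, `|knum w j - knum w0 j| <= (72 * n%:R + 32) * eps * r ^+ 3.
Proof.
move=> r0 e0 hw hw0 ht hd hdt j.
have hS : enorm w.1 ^+ 2 <= 8 * n%:R * r ^+ 2.
  by apply: le_trans (enorm_sqr_le hw) _; rewrite natrD; lra.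
have hS' : `|enorm w.1 ^+ 2 - enorm w0.1 ^+ 2| <= 8 * n%:R * eps * r ^+ 2.
  rewrite !enorm_sqr -sumrB; apply: (le_trans (ler_norm_sum _ _ _)).
  apply: (@le_trans _ _ (\sum_(i < n + n) (4 * eps * r ^+ 2))); last first.
    by rewrite sumr_const card_ord -[leLHS]mulr_natr natrD; lra.
  apply: ler_sum => i _.
  apply: (le_trans (normM_diff (hd i) (hw i) (hw0 i) (hd i))).
  by rewrite expr2; lra.
move: hS hS'; set S := enorm w.1 ^+ 2; set S0 := enorm w0.1 ^+ 2 => hS hS'.
have hSn : `|S| <= 8 * n%:R * r ^+ 2 by rewrite ger0_norm// sqr_ge0.
have A i := normM_diff (hd i) hSn (hw0 i) hS'.
have B i := normM_diff (hd i) ht (hw0 i) hdt.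
have r3 : r ^+ 3 = r * r ^+ 2 by ring.
rewrite /knum /hx /hy -/S -/S0; case: fintype.split => i.
- have := A (lshift n i); have := B (rshift n i); rewrite r3 !ler_norml.
  by move=> /andP[? ?] /andP[? ?]; apply/andP; split; lra.
- have := A (rshift n i); have := B (lshift n i); rewrite r3 !ler_norml.
  by move=> /andP[? ?] /andP[? ?]; apply/andP; split; lra.
Qed.

Lemma knum_le w (r : R) : 0 <= r -> (forall j, `|w.1 0 j| <= 2 * r) ->
  `|w.2| <= (n%:R + 2) * r ^+ 2 ->
  forall j, `|knum w j| <= (48 * n%:R + 32) * r ^+ 3.
Proof.
move=> r0 hw ht j.
have hS : enorm w.1 ^+ 2 <= 8 * n%:R * r ^+ 2.
  by apply: le_trans (enorm_sqr_le hw) _; rewrite natrD; lra.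
move: hS; set S := enorm w.1 ^+ 2 => hS.
have hSn : `|S| <= 8 * n%:R * r ^+ 2 by rewrite ger0_norm// sqr_ge0.
have A i := normM_le (hw i) hSn.
have B i := normM_le (hw i) ht.
have r3 : r ^+ 3 = r * r ^+ 2 by ring.
rewrite /knum /hx /hy -/S; case: fintype.split => i.
- have := A (lshift n i); have := B (rshift n i); rewrite r3 !ler_norml.
  by move=> /andP[? ?] /andP[? ?]; apply/andP; split; lra.
- have := A (rshift n i); have := B (lshift n i); rewrite r3 !ler_norml.
  by move=> /andP[? ?] /andP[? ?]; apply/andP; split; lra.
Qed.

(** In complex notation w = x_i + i y_i the pair of components with index i is
    - 2 (|z|^2 + 4 i t) w, of modulus at least 2 |z|^2 |w|: it only vanishes
    where the horizontal coordinate w does. *)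
Lemma knum_ge w (s : R) j : 0 <= s -> s <= `|w.1 0 j| ->
  exists j', s ^+ 3 <= `|knum w j'|.
Proof.
move=> s0 hs.
have hS : s ^+ 2 <= enorm w.1 ^+ 2.
  rewrite lerXn2r ?nnegrE ?enorm_ge0//.
  exact: le_trans hs (coord_le_enorm _ _).
have hj : s ^+ 2 <= w.1 0 j ^+ 2.
  by rewrite -[leRHS]real_normK ?num_real// lerXn2r ?nnegrE.
pose i := match fintype.split j with inl i => i | inr i => i end.
have hi : s ^+ 2 <= hx w i ^+ 2 + hy w i ^+ 2.
  apply: (le_trans hj); rewrite /hx /hy /i.
  by case: splitP => k jk;
    [rewrite (_ : j = lshift n k)|rewrite (_ : j = rshift n k)];
    rewrite ?lerDl ?lerDr ?sqr_ge0//; apply/val_inj.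
(* The sum of the squares of the two components with index i. *)
have key : s ^+ 6 *+ 4 <= knum w (lshift n i) ^+ 2 + knum w (rshift n i) ^+ 2.
  have sl : fintype.split (lshift n i) = inl i by exact: (unsplitK (inl i)).
  have sr : fintype.split (rshift n i) = inr i by exact: (unsplitK (inr i)).
  rewrite /knum sl sr.
  set X := hx w i in hi *; set Y := hy w i in hi *;
    set S := enorm _ ^+ 2 in hS *.
  have -> : (- 2 * X * S + 8 * Y * w.2) ^+ 2 + (- 2 * Y * S - 8 * X * w.2) ^+ 2
     = (X ^+ 2 + Y ^+ 2) * (4 * S ^+ 2 + 64 * w.2 ^+ 2) by ring.
  have -> : s ^+ 6 *+ 4 = s ^+ 2 * (4 * (s ^+ 2) ^+ 2) by rewrite -mulr_natl;
    ring.
  have hSS : (s ^+ 2) ^+ 2 <= S ^+ 2 by rewrite lerXn2r ?nnegrE ?sqr_ge0.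
  apply: ler_pM => //; rewrite ?mulr_ge0 ?sqr_ge0//.
  by have := sqr_ge0 w.2; lra.
have [h|h] := leP (s ^+ 3) `|knum w (lshift n i)|; first by exists (lshift n i).
have [h'|h'] := leP (s ^+ 3) `|knum w (rshift n i)|;
  first by exists (rshift n i).
exfalso; move: key.
have f (u : R) : `|u| < s ^+ 3 -> u ^+ 2 <= s ^+ 6 /\ 0 < s ^+ 6.
  move=> hu; rewrite -[u ^+ 2]real_normK ?num_real// (exprM s 3 2) lerXn2r
    ?nnegrE ?exprn_ge0//.
    by split=> //; rewrite exprn_gt0// (le_lt_trans _ hu).
  exact: ltW.
have [u1 u0] := f _ h; have [u2 _] := f _ h'.
by rewrite -mulr_natl; lra.
Qed.

End Geometry.

(** * Pigeonholing and nonnegative integrals on a measure space *)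

Section Measure.
Context {d : measure_display} {T : measurableType d} {R : realType}.
Context (mu : {measure set T -> \bar R}).

Lemma le_measureW (A B : set T) : measurable A -> measurable B -> A `<=` B ->
  (mu A <= mu B)%E.
Proof. by move=> mA mB AB; apply: le_measure; rewrite ?inE. Qed.

Lemma measure_le2 (A B C : set T) : measurable A -> measurable B ->
  measurable C ->
  A `<=` B `|` C -> (mu A <= mu B + mu C)%E.
Proof.
move=> mA mB mC h; have mBC := measurableU _ _ mB mC.
by apply: (le_trans (le_measureW mA mBC h)); exact: measureU2.
Qed.

(** Finite subadditivity for a cover indexed by a sequence, possibly with
    repetitions. *)
Lemma measure_seq_cover (I : eqType) (F : I -> set T) (s : seq I) (A : set T) :
  (forall i, measurable (F i)) -> measurable A ->
  (forall x, A x -> exists2 i, i \in s & F i x) ->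
  (mu A <= \sum_(i <- s) mu (F i))%E.
Proof.
move=> mF; elim: s A => [|i s IH] A mA h.
  rewrite big_nil (_ : A = set0) ?measure0//.
  by apply/seteqP; split=> // x /h[].
rewrite big_cons.
have mD : measurable (A `\` F i) by exact: measurableD.
apply: (le_trans (measure_le2 mA (mF i) mD _)).
  by move=> x Ax; have [Fx|Fx] := pselect (F i x); [left|right].
rewrite leeD2l// IH// => x [Ax Fx].
have [j] := h _ Ax; rewrite inE => /orP[/eqP -> //|js Fj].
by exists j.
Qed.

Definition has_measurable_levels (g : T -> R) : Prop :=
  forall a, measurable [set x | g x <= a] /\ measurable [set x | a <= g x].

(** Bisect the range of g, each time keeping the half that carries more mass. *)
Lemma halving (g : T -> R) (l a : R) (k : nat) (A : set T) :
  has_measurable_levels g -> measurable A ->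
  (forall x, A x -> a <= g x <= a + l) ->
  exists A', [/\ measurable A', A' `<=` A, (mu A <= (2 ^+ k)%:E * mu A')%E &
    forall x y, A' x -> A' y -> `|g x - g y| <= l / 2 ^+ k].
Proof.
move=> mg; elim: k l a A => [|k IH] l a A mA h.
  exists A; split=> //; rewrite ?expr0 ?mul1e// =>
    x y /h/andP[? ?] /h/andP[? ?].
  by rewrite divr1 ler_norml; apply/andP; split; lra.
pose m := a + l / 2.
have [mlo mhi] := mg m.
suff [B [a' [mB BA muB hB]]] : exists B a', [/\ measurable B, B `<=` A,
    (mu A <= 2%:E * mu B)%E & forall x, B x -> a' <= g x <= a' + l / 2].
  have [A' [mA' A'B muA' hA']] := IH _ _ _ mB hB.
  exists A'; split=> //.
  - exact: subset_trans BA.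
  - apply: (le_trans muB); rewrite exprS EFinM -muleA.
    by rewrite lee_pmul2l.
  - by move=> x y Ax Ay; rewrite exprS invfM mulrA; exact: hA'.
pose B1 := A `&` [set x | g x <= m]; pose B2 := A `&` [set x | m <= g x].
have mB1 : measurable B1 by exact: measurableI.
have mB2 : measurable B2 by exact: measurableI.
have cov : (mu A <= mu B1 + mu B2)%E.
  apply: measure_le2 => // x Ax.
  by have [gx|/ltW gx] := leP (g x) m; [left|right].
have two (u : \bar R) : (2%:E * u = u + u)%E.
  by rewrite mule_natl mule2n.
have [le12|/ltW le21] := leP (mu B1) (mu B2).
- exists B2, m; split=> //; first by move=> x [].
    by rewrite two; apply: (le_trans cov); rewrite leeD2r.
  by move=> x [/h/andP[? ?] /= H]; move: H; rewrite /m => H; apply/andP; split;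
    lra.
- exists B1, a; split=> //; first by move=> x [].
    by rewrite two; apply: (le_trans cov); rewrite leeD2l.
  by move=> x [/h/andP[? ?] /= H]; move: H; rewrite /m => H; apply/andP; split;
    lra.
Qed.

Lemma pigeonhole_seq (J : eqType) (g : J -> T ->
  R) (b : R) (k : nat) (s : seq J)
    (A : set T) :
  (forall j, has_measurable_levels (g j)) -> measurable A ->
  (forall j x, A x -> `|g j x| <= b) ->
  exists A', [/\ measurable A', A' `<=` A,
    (mu A <= (2 ^+ (k * size s))%:E * mu A')%E &
    forall j, j \in s -> forall x y, A' x -> A' y ->
       `|g j x - g j y| <= 2 * b / 2 ^+ k].
Proof.
move=> mg; elim: s A => [|j s IH] A mA hA.
  by exists A; split=> //; rewrite muln0 expr0 mul1e.
have [B [mB BA muB oB]] := IH _ mA hA.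
have hB x : B x -> - b <= g j x <= - b + 2 * b.
  by move=> /BA /(hA j); rewrite ler_norml => /andP[? ?]; apply/andP; split;
    lra.
have [A' [mA' A'B muA' oA']] := halving k (mg j) mB hB.
exists A'; split=> //.
- exact: subset_trans BA.
- apply: (le_trans muB); rewrite /= mulnS addnC exprD EFinM -muleA.
  by rewrite lee_pmul2l// lte_fin exprn_gt0.
- move=> i; rewrite inE => /orP[/eqP ->|si] x y Ax Ay; first exact: oA'.
  by apply: oB => //; exact: A'B.
Qed.

(** The integral of a nonnegative function is by definition a supremum over the
    simple functions below it, hence is monotone also on functions that are not
    known to be measurable, such as the truncated Riesz transforms. *)
Lemma ge0_le_integral_all (D : set T) (f g : T -> \bar R) :
  (forall x, D x -> (0 <= f x)%E) -> (forall x, D x -> (f x <= g x)%E) ->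
  (\int[mu]_(x in D) f x <= \int[mu]_(x in D) g x)%E.
Proof.
move=> f0 fg; rewrite !ge0_integralE//; last first.
  by move=> x Dx; exact: le_trans (f0 _ Dx) (fg _ Dx).
apply: ge_ereal_sup => _ [h /= hf <-]; apply: ereal_sup_ubound;
  exists h => //= x.
by apply: (le_trans (hf x)); rewrite /patch; case: ifPn => // /set_mem/fg.
Qed.

Lemma integral_cst_indic (D A : set T) (c : R) : measurable D -> measurable A ->
  A `<=` D -> 0 <= c -> (\int[mu]_(x in D) (c * \1_A x)%:E = c%:E * mu A)%E.
Proof.
move=> mD mA AD c0.
under eq_integral do rewrite EFinM.
rewrite ge0_integralZl//; last by apply/measurable_EFinP;
  exact: measurable_indic.
by rewrite integral_indic// (setIidl AD).
Qed.

Lemma integral_ge_indic (D A : set T) (f : T -> \bar R) (c : R) :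
  measurable D -> measurable A -> A `<=` D -> 0 <= c ->
  (forall x, D x -> (0 <= f x)%E) -> (forall x, A x -> (c%:E <= f x)%E) ->
  (c%:E * mu A <= \int[mu]_(x in D) f x)%E.
Proof.
move=> mD mA AD c0 f0 cf; rewrite -(integral_cst_indic mD)//.
apply: ge0_le_integral_all => x Dx; first by rewrite lee_fin mulr_ge0.
rewrite indicE; case: (boolP (x \in A)) => [/set_mem/cf|]; rewrite ?mulr1//.
by rewrite mulr0 f0.
Qed.

(** The upper bound M only serves to make the integral finite: the real-valued
    integral of a function with infinite integral is 0. *)
Lemma Rintegral_ge_indic (D A : set T) (f : T -> R) (c M : R) :
  measurable D -> measurable A -> A `<=` D -> (mu A < +oo)%E -> 0 <= c ->
  (forall x, A x -> c <= f x <= M) -> (forall x, ~ A x -> f x = 0) ->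
  c * fine (mu A) <= \int[mu]_(x in D) f x.
Proof.
move=> mD mA AD fA c0 fc f0.
have fge0 x : 0 <= f x.
  have [/fc/andP[h _]|/f0 ->//] := pselect (A x); exact: le_trans h.
have h1 : (c%:E * mu A <= \int[mu]_(x in D) (f x)%:E)%E.
  apply: integral_ge_indic => // x; first by rewrite lee_fin.
  by move=> /fc/andP[]; rewrite lee_fin.
have h2 : (\int[mu]_(x in D) (f x)%:E <= `|M|%:E * mu A)%E.
  rewrite -(integral_cst_indic mD)//; apply: ge0_le_integral_all => x _;
    rewrite lee_fin//.
  rewrite indicE; case: (boolP (x \in A)) => [/set_mem/fc/andP[_ h]|].
    by rewrite mulr1 (le_trans h)// ler_norm.
  by move=> /negP nA; rewrite f0 ?mulr0// => /mem_set.
have fin : mu A \is a fin_num by rewrite ge0_fin_numE.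
rewrite /Rintegral -lee_fin EFinM fineK// fineK//.
rewrite ge0_fin_numE; last by apply: integral_ge0 => x _; rewrite lee_fin.
by apply: (le_lt_trans h2); rewrite -(fineK fin) -EFinM ltry.
Qed.

Lemma normr_Rintegral_ge_indic (D A : set T) (f : T -> R) (c M : R) :
  measurable D -> measurable A -> A `<=` D -> (mu A < +oo)%E -> 0 <= c ->
  (forall x, A x -> c <= f x <= M) \/ (forall x, A x -> c <= - f x <= M) ->
  (forall x, ~ A x -> f x = 0) ->
  c * fine (mu A) <= `|\int[mu]_(x in D) f x|.
Proof.
move=> mD mA AD fA c0 fc f0; case: fc => fc.
  apply: le_trans (ler_norm _).
  by apply: Rintegral_ge_indic fc f0.
have fc0 x : 0 <= - f x.
  by have [/fc/andP[h _]|/f0 ->] := pselect (A x);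
    [exact: le_trans h|rewrite oppr0].
have -> : (\int[mu]_(x in D) f x = - \int[mu]_(x in D) (- f x))%R.
  rewrite /Rintegral -fineN -integral_ge0N; last by move=> x _; rewrite lee_fin.
  by under [in RHS]eq_integral do rewrite -EFinN opprK.
rewrite normrN; apply: le_trans (ler_norm _).
by apply: Rintegral_ge_indic fc _ => // x /f0 ->; rewrite oppr0.
Qed.

Lemma Lnorm2_indic (A : set T) : measurable A ->
  Lnorm mu 2%:E (EFin \o \1_A) = (mu A `^ 2^-1)%E.
Proof.
move=> mA; rewrite unlock; congr poweR.
rewrite -[RHS]mul1e -(integral_cst_indic measurableT)//.
apply: eq_integral => x _ /=; rewrite mul1r indicE.
by case: (x \in A); rewrite /= ?normr1 ?normr0 ?powR1 ?powR0.
Qed.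

(** Testing an L^2 inequality on an indicator function. *)
Lemma Lnorm2_indic_test (A W : set T) (g : T -> R) (c C : R) :
  measurable A -> measurable W -> 0 <= c -> 0 <= C ->
  (forall x, 0 <= g x) -> (forall x, W x -> c <= g x) ->
  (Lnorm mu 2%:E (fun x => (g x)%:E)
     <= C%:E * Lnorm mu 2%:E (EFin \o \1_A))%E ->
  ((c ^+ 2)%:E * mu W <= (C ^+ 2)%:E * mu A)%E.
Proof.
move=> mA mW c0 C0 g0 cg; rewrite Lnorm2_indic// unlock.
set I := (\int[mu]_x _)%E => h.
have I0 : (0 <= I)%E by apply: integral_ge0 => x _; exact: poweR_ge0.
have IW : ((c ^+ 2)%:E * mu W <= I)%E.
  apply: integral_ge_indic => //; first by rewrite sqr_ge0.
    by move=> x _; exact: poweR_ge0.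
  move=> x Wx; rewrite abse_EFin poweR_EFin lee_fin powR_mulrn// ger0_norm//.
  by rewrite lerXn2r ?nnegrE// cg.
apply: (le_trans IW).
have sq (x : \bar R) : (0 <= x)%E -> ((x `^ 2^-1) `^ 2 = x)%E.
  by move=> x0; rewrite -poweRrM mulVf// poweRe1.
have := gt0_ler_poweR (ler0n R 2) _ _ h.
rewrite !in_itv /= !leey !poweR_ge0 !mule_ge0 ?poweR_ge0 ?lee_fin//=.
move=> /(_ isT isT); rewrite poweRM ?poweR_ge0 ?lee_fin// !sq//.
by rewrite poweR_EFin powR_mulrn.
Qed.

End Measure.

(** * Boxes and balls are Borel *)

Section Topology.
Context {R : realType} {n : nat}.

Lemma continuous_coord (j : 'I_(n + n)) : 
  continuous (fun p : heis R n => p.1 0 j).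
Proof.
move=> p; apply: (@continuous_comp _ _ _ fst (fun a : 'rV[R]_(n + n) => a 0 j)).
  exact: cvg_fst.
exact: coord_continuous.
Qed.

Lemma continuous_t : continuous (fun p : heis R n => p.2).
Proof. by move=> p; exact: cvg_snd. Qed.

Section ContinuousReal.
Context {T : topologicalType}.
Implicit Types f g : T -> R.

Lemma continuous_cst (a : R) : continuous (fun _ : T => a).
Proof. by move=> x; exact: cst_continuous. Qed.

Lemma continuous_add f g : continuous f -> continuous g ->
  continuous (fun x => f x + g x).
Proof. by move=> cf cg x; exact: cvgD (cf x) (cg x). Qed.

Lemma continuous_sub f g : continuous f -> continuous g ->
  continuous (fun x => f x - g x).
Proof. by move=> cf cg x; exact: cvgB (cf x) (cg x). Qed.

Lemma continuous_mul f g : continuous f -> continuous g ->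
  continuous (fun x => f x * g x).
Proof. by move=> cf cg x; exact: cvgM (cf x) (cg x). Qed.

Lemma continuous_sqr f : continuous f -> continuous (fun x => f x ^+ 2).
Proof. by move=> cf; exact: continuous_mul. Qed.

Lemma continuous_sum (I : Type) (s : seq I) (f : I -> T -> R) :
  (forall i, continuous (f i)) -> continuous (fun x : T => \sum_(i <- s) f i x).
Proof.
move=> hf; elim: s => [|i s IH].
  rewrite (_ : (fun x => _) = (fun=> 0)); first exact: continuous_cst.
  by apply/funext => x; rewrite big_nil.
rewrite (_ : (fun x => _) = (fun x => f i x + \sum_(j <- s) f j x)).
  exact: continuous_add.
by apply/funext => x; rewrite big_cons.
Qed.

Lemma closed_norm_le f (a : R) : continuous f -> closed [set x | `|f x| <= a].
Proof.
move=> cf.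
have cn : continuous (fun x => `|f x|).
  by move=> x; apply: continuous_comp; [exact: cf|exact: norm_continuous].
exact: ((continuous_closedP (fun x => `|f x|)).1 cn _ (@closed_le _ a)).
Qed.

End ContinuousReal.

Lemma continuous_vert (c : heis R n) : continuous (vert c).
Proof.
have -> : vert c = (fun p => p.2 - c.2 - 2^-1 * omega c.1 p.1).
  by apply/funext => p; rewrite vertE.
apply: continuous_sub.
  by apply: continuous_sub; [exact: continuous_t|exact: continuous_cst].
apply: continuous_mul; first exact: continuous_cst.
apply: continuous_sum => i.
by apply: continuous_sub; apply: continuous_mul;
  [exact: continuous_cst|exact: continuous_coord|exact: continuous_cst|exact:
    continuous_coord].
Qed.

Lemma closed_box (c : heis R n) r : closed (box c r).
Proof.
have -> : box c r = \bigcap_j [set p : heis R n | `|p.1 0 j - c.1 0 j| <= r]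
     `&` [set p | `|vert c p| <= r ^+ 2].
  by apply/seteqP; split=> p [h1 h2]; split=> // j; [move=> _|]; exact: h1.
apply: closedI; last by apply: closed_norm_le; exact: continuous_vert.
apply: closed_bigI => j _; apply: closed_norm_le.
by apply: continuous_sub; [exact: continuous_coord|exact: continuous_cst].
Qed.

Lemma compact_box (c : heis R n) r : compact (box c r).
Proof.
pose X : set 'rV[R]_(n + n) :=
  [set v | forall j, `[c.1 0 j - r, c.1 0 j + r]%classic (v ord0 j)].
pose M := r ^+ 2 + `|c.2| + 2 * n%:R * (enorm c.1 * (enorm c.1 + r)).
have cX : compact X.
  apply: (@rV_compact R _ (fun j => `[c.1 0 j - r, c.1 0 j + r]%classic)) => j.
  exact: segment_compact.
have cY : compact `[- M, M]%classic by exact: segment_compact.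
have cXY := compact_setX cX cY.
refine (subclosed_compact (@closed_box c r) cXY _).
move=> p [h1 h2]; split=> /=.
  by move=> j; rewrite /= in_itv /=; have := h1 j;
    rewrite ler_norml => /andP[? ?]; apply/andP; split; lra.
rewrite in_itv /= -ler_norml.
have ho : `|omega c.1 p.1| <= 2 * n%:R * (enorm c.1 * (enorm c.1 + r)).
  apply: omega_le => j; first exact: coord_le_enorm.
  rewrite (_ : p.1 0 j = c.1 0 j + (p.1 0 j - c.1 0 j)); last by ring.
  by rewrite (le_trans (ler_normD _ _))// lerD ?coord_le_enorm.
have -> : p.2 = vert c p + c.2 + 2^-1 * omega c.1 p.1 by rewrite vertE; ring.
have h3 := ler_normD (vert c p + c.2) (2^-1 * omega c.1 p.1).
have h4 := ler_normD (vert c p) c.2.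
have h5 : `|2^-1 * omega c.1 p.1| = 2^-1 * `|omega c.1 p.1| by rewrite normrM
  ger0_norm.
by have := normr_ge0 (omega c.1 p.1); move: h3 h4 ho h2; rewrite /M h5; lra.
Qed.

Lemma closed_hball (x : heis R n) r : closed (hball x r).
Proof.
have [r0|r0] := leP 0 r; last first.
  rewrite (_ : hball x r = set0); first exact: closed0.
  by apply/seteqP; split=> // p /= /(le_trans (knorm_ge0 _)); rewrite leNgt r0.
have -> : hball x r = [set q : heis R n |
    `|(\sum_j (x.1 0 j - q.1 0 j) ^+ 2) ^+ 2 + 16 * vert q x ^+ 2| <= r ^+ 4].
  apply/seteqP; have E q : hdist x q ^+ 4 =
      `|(\sum_j (x.1 0 j - q.1 0 j) ^+ 2) ^+ 2 + 16 * vert q x ^+ 2|.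
    rewrite knorm4 (exprM _ 2 2) enorm_sqr ger0_norm; last first.
      by apply: addr_ge0; [exact: sqr_ge0|rewrite mulr_ge0 ?sqr_ge0].
    congr (_ ^+ 2 + _); apply: eq_bigr => j _.
    by rewrite -/(hdiff q x) hdiff1.
  by split=> q; rewrite /hball /mkset -E /hdist knorm_le.
apply: closed_norm_le; apply: continuous_add.
  apply: continuous_sqr; apply: continuous_sum => j; apply: continuous_sqr.
  by apply: continuous_sub; [exact: continuous_cst|exact: continuous_coord].
apply: continuous_mul; first exact: continuous_cst.
apply: continuous_sqr.
have -> : (fun q => vert q x) = (fun q => 0 - vert x q).
  by apply/funext => p; rewrite vert_anti sub0r.
by apply: continuous_sub; [exact: continuous_cst|exact: continuous_vert].
Qed.

Lemma measurable_closed (F : set (heis R n)) : closed F ->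
  measurable (F : set (heis_borel R n)).
Proof.
move=> cF; rewrite -(setCK F); apply: measurableC.
by apply: sub_sigma_algebra; exact: closed_openC.
Qed.

Lemma measurable_box (c : heis R n) r :
  measurable (box c r : set (heis_borel R n)).
Proof. by apply: measurable_closed; exact: closed_box. Qed.

Lemma measurable_hball (c : heis R n) r :
  measurable (hball c r : set (heis_borel R n)).
Proof. by apply: measurable_closed; exact: closed_hball. Qed.

Lemma continuous_levels (g : heis R n -> R) : continuous g ->
  has_measurable_levels (g : heis_borel R n -> R).
Proof.
move=> cg a; split; apply: measurable_closed.
  exact: ((continuous_closedP g).1 cg _ (@closed_le _ a)).
exact: ((continuous_closedP g).1 cg _ (@closed_ge _ a)).
Qed.

End Topology.

(** * Vertical tubes: covering them, and the kernel off them *)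

(** A lower bound for the size of the kernel between two points of a box of
    radius r with horizontal distance more than eta r. *)
Definition kernel_bound (R : realType) (n : nat) (eta r : R) : R :=
  n%:R * (2^-1 * (eta * r) ^+ 3 / (box_diam R n * r) ^+ (2 * n + 4)).

Section Tube.
Context {R : realType} {n : nat}.
Implicit Types p q c x w : heis R n.

(** The union of the boxes of radius r centred at the points of s. *)
Definition boxes (s : seq (heis R n)) (r : R) : set (heis R n) :=
  [set p | exists2 c, c \in s & box c r p].

Definition tube q (r : R) : set (heis R n) :=
  [set p : heis R n | forall j, `|p.1 0 j - q.1 0 j| <= r].

Lemma closed_tube q r : closed (tube q r).
Proof.
have -> : tube q r = \bigcap_j [set p : heis R n | `|p.1 0 j - q.1 0 j| <= r].
  by apply/seteqP; split=> p h j; [move=> _|]; exact: h.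
apply: closed_bigI => j _; apply: closed_norm_le.
by apply: continuous_sub; [exact: continuous_coord|exact: continuous_cst].
Qed.

Lemma closed_boxes s r : closed (boxes s r).
Proof.
elim: s => [|c s IH].
  rewrite (_ : boxes _ _ = set0); first exact: closed0.
  by apply/seteqP; split=> // p [].
rewrite (_ : boxes _ _ = box c r `|` boxes s r).
  by apply: closedU => //; exact: closed_box.
apply/seteqP; split=> p.
  by move=> [c' +]; rewrite inE => /orP[/eqP -> ?|c's hc']; [left|right;
    exists c'].
by move=> [?|[c' c's ?]]; [exists c; rewrite ?mem_head|exists c';
  rewrite // inE c's orbT].
Qed.

Lemma grid_cover (h u : R) (m : nat) : 0 < h -> (0 < m)%N ->
  0 <= u -> u <= 2 * m%:R * h ->
  exists2 i, (i < m)%N & `|u - (2 * i%:R + 1) * h| <= h.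
Proof.
move=> h0; elim: m => // m IH _ u0.
have [um _|um] := leP u (2 * m%:R * h); last first.
  move=> um'; exists m => //; move: um um'.
  by rewrite -[m.+1]addn1 natrD ler_norml => ? ?; apply/andP; split; lra.
case: m IH um => [_ um|m IH um].
  by exists 0%N => //; rewrite ler_norml; apply/andP; split; lra.
by have [i im hi] := IH isT u0 um; exists i => //; exact: ltnW.
Qed.

(** The centres are spread along the vertical line through q, with spacing
    2 (r / 2^k)^2 in the vertical coordinate, which is at most (n+2) r^2 in
    absolute value on the box. *)
Lemma tube_cover x q (r : R) (k : nat) : 0 < r -> box x r q ->
  exists2 s, (size s = (n + 2) * 4 ^ k)%N &
    box x r `&` tube q (r / 2 ^+ k) `<=` boxes s (r / 2 ^+ k).
Proof.
move=> r0 hq; set rho := r / 2 ^+ k; set m := ((n + 2) * 4 ^ k)%N.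
have rho0 : 0 < rho by rewrite divr_gt0// exprn_gt0.
have h0 : 0 < rho ^+ 2 by rewrite exprn_gt0.
have m0 : (0 < m)%N by rewrite muln_gt0 addn_gt0 orbT expn_gt0.
have mh : m%:R * rho ^+ 2 = (n%:R + 2) * r ^+ 2.
  rewrite /m /rho natrM natrD natrX expr_div_n -exprM mulnC exprM.
  rewrite (_ : 2 ^+ 2 = 4 :> R); last by rewrite expr2 -natrM.
  by rewrite -mulrA [X in _ * X]mulrC divfK// expf_neq0.
pose c i : heis R n := (q.1,
  q.2 + ((2 * i%:R + 1) * rho ^+ 2 - m%:R * rho ^+ 2)).
exists [seq c i | i <- iota 0 m]; first by rewrite size_map size_iota.
move=> p [hp hpt].
have := vert_le_box hq hp; rewrite -mh ler_norml => /andP[v1 v2].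
have [i im hi] := @grid_cover _ (vert q p + m%:R * rho ^+ 2) m h0 m0 ltac:(lra)
  ltac:(lra).
exists (c i); first by apply/mapP; exists i; rewrite // mem_iota.
split; first exact: hpt.
apply: le_trans hi; rewrite !vertE /c /= le_eqVlt; apply/orP; left; apply/eqP;
  congr `|_|.
by ring.
Qed.

Lemma quotient_bounds (m : nat) (a b N u v V : R) : 0 < a -> a <= N -> N <= b ->
  0 <= u -> u <= v -> v <= V ->
  u / b ^+ m <= v / N ^+ m <= V / a ^+ m.
Proof.
move=> a0 aN Nb u0 uv vV.
have N0 := lt_le_trans a0 aN.
have mono (y z s t : R) : 0 < s -> s <= t -> 0 <= y -> y <= z ->
    y / t ^+ m <= z / s ^+ m.
  move=> s0 st y0 yz; have t0 := lt_le_trans s0 st.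
  apply: ler_pM => //; first by rewrite invr_ge0 exprn_ge0// ltW.
  by rewrite lef_pV2 ?posrE ?exprn_gt0// lerXn2r// nnegrE ltW.
by apply/andP; split; apply: mono => //; exact: le_trans uv.
Qed.

(** When q runs over a set A of small oscillation, the numerator of
    K(q^-1 p) changes by at most half of the size of a suitable component at q0,
    so that this component keeps its sign.  The component depends on p, but not
    on q, which rules out cancellation in the integral over A. *)
Lemma riesz_kernel_sign x q0 p (A : set (heis R n)) (r eta eps : R) :
  0 < r -> 0 < eta -> 0 <= eps -> eps <= eta / 2 ->
  (72 * n%:R + 32) * eps <= eta ^+ 3 / 2 ->
  A `<=` box x r -> box x r q0 -> box x r p -> ~ tube q0 (eta * r) p ->
  (forall q, A q -> forall j, `|q.1 0 j - q0.1 0 j| <= eps * r) ->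
  (forall q, A q -> `|vert x q - vert x q0| <= eps * r ^+ 2) ->
  (forall q, A q -> eta * r / 2 <= hdist p q) /\
  exists j M,
    (forall q, A q ->
       kernel_bound n eta r <= riesz_kernel (hmul (hinv q) p) 0 j <= M) \/
    (forall q, A q ->
       kernel_bound n eta r <= - riesz_kernel (hmul (hinv q) p) 0 j <= M).
Proof.
move=> r0 eta0 eps0 eps2 epsn AB hq0 hp npt oscz osct.
have [j0 hj0] : exists j, eta * r < `|p.1 0 j - q0.1 0 j|.
  apply: contra_notP npt => /forallNP h j; rewrite leNgt; apply/negP; exact: h.
have far q : A q -> eta * r / 2 <= hdist p q.
  move=> Aq; apply: le_trans (coord_le_knorm _ j0);
    rewrite -/(hdiff q p) hdiff1.
  have h1 := oscz _ Aq j0.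
  have h2 := ler_normD (p.1 0 j0 - q.1 0 j0) (q.1 0 j0 - q0.1 0 j0).
  rewrite subrKA in h2.
  have h3 : eps * r <= eta / 2 * r by rewrite ler_wpM2r// ltW.
  by lra.
split=> //.
have er0 : 0 <= eta * r by rewrite mulr_ge0// ltW.
have [j hj] : exists j, (eta * r) ^+ 3 <= `|knum (hdiff q0 p) j|.
  by apply: (knum_ge (j := j0)) => //; rewrite hdiff1 ltW.
have N0 : 0 <= n%:R :> R by [].
have kdiff q : A q -> `|knum (hdiff q p) j - knum (hdiff q0 p) j| <= 2^-1 *
  (eta * r) ^+ 3.
  move=> Aq; have hq := AB _ Aq.
  apply: (le_trans (knum_diff (r := r) (eps := eps) _ _ _ _ _ _ _ _)) => //.
  - exact: ltW.
  - by move=> i; rewrite hdiff1; exact: diff_le_box hq hp i.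
  - by move=> i; rewrite hdiff1; exact: diff_le_box hq0 hp i.
  - exact: vert_le_box hq hp.
  - move=> i; rewrite !hdiff1.
    rewrite (_ : _ - _ = - (q.1 0 i - q0.1 0 i)); last by ring.
    by rewrite normrN; exact: oscz.
  - rewrite !hdiff2 (vert_cocycle x q p) (vert_cocycle x q0 p).
    have ho : `|omega (q.1 - q0.1) (p.1 - x.1)| <= 2 * n%:R * (eps * r * r).
      by apply: omega_le => i; rewrite !mxE; [exact: oscz|case: hp => + _;
        exact].
    have -> : vert x p - vert x q - 2^-1 * omega (q.1 - x.1) (p.1 - x.1) -
       (vert x p - vert x q0 - 2^-1 * omega (q0.1 - x.1) (p.1 - x.1)) =
       - (vert x q - vert x q0) - 2^-1 * omega (q.1 - q0.1) (p.1 - x.1).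
      have -> : omega (q.1 - q0.1) (p.1 - x.1) = omega (q.1 - x.1) (p.1 - x.1) -
          omega (q0.1 - x.1) (p.1 - x.1).
        by rewrite /omega -sumrB; apply: eq_bigr => i _; rewrite !mxE; ring.
      by ring.
    apply: (le_trans (ler_normB _ _)); rewrite normrN normrM ger0_norm//.
    by have := osct _ Aq; lra.
  - have := ler_wpM2r (exprn_ge0 3 (ltW r0)) epsn.
    by rewrite (_ : (eta * r) ^+ 3 = eta ^+ 3 * r ^+ 3); [lra|ring].
have ksize q : A q -> `|knum (hdiff q p) j| <= (48 * n%:R + 32) * r ^+ 3.
  move=> Aq; have hq := AB _ Aq; apply: knum_le; first exact: ltW.
    by move=> i; rewrite hdiff1; exact: diff_le_box hq hp i.
  exact: vert_le_box hq hp.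
pose M := n%:R * ((48 * n%:R + 32) * r ^+ 3 / (eta * r / 2) ^+ (2 * n + 4)).
have kb q v : A q -> 2^-1 * (eta * r) ^+ 3 <= v ->
  v <= (48 * n%:R + 32) * r ^+ 3 ->
   kernel_bound n eta r <= n%:R * (v / knorm (hdiff q p) ^+ (2 * n + 4)) <= M.
  move=> Aq v1 v2.
  have a0 : 0 < eta * r / 2 by rewrite divr_gt0// mulr_gt0.
  have Nb := hdist_le_box (ltW r0) (AB _ Aq) hp.
  have u0 : 0 <= 2^-1 * (eta * r) ^+ 3 by rewrite mulr_ge0// exprn_ge0.
  have /andP[h1 h2] := quotient_bounds (2 * n + 4) a0 (far _ Aq) Nb u0 v1 v2.
  by apply/andP; split; exact: ler_wpM2l.
exists j, M.
have [s0|s0] := leP 0 (knum (hdiff q0 p) j); [left|right] => q Aq.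
- rewrite riesz_kernelE; apply: kb => //.
    by have := kdiff _ Aq; move: hj; rewrite ger0_norm// ler_norml =>
      h /andP[? ?]; lra.
  by apply: le_trans (ksize _ Aq); exact: ler_norm.
- rewrite riesz_kernelE -mulrN -mulNr; apply: kb => //.
    by have := kdiff _ Aq; move: hj; rewrite ltr0_norm// ler_norml =>
      h /andP[? ?]; lra.
  by apply: le_trans (ksize _ Aq); rewrite -normrN; exact: ler_norm.
Qed.

End Tube.

(** * Little mass off a vertical tube *)

(** The bounds of [mass_off_tube] are
    [off_tube_const n C * off_tube_base R n ^+ k] times r^(2n+1) / Theta, in
    which C is the L^2 bound and 2^(-k) the relative width of the tube.  The
    powers of 2 come mostly from the number 2^((3k+n+9)(2n+1)) of pieces, the
    denominator from [kernel_bound]. *)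
Definition off_tube_const (R : realType) (n : nat) (C : R) : R :=
  C ^+ 2 * 2 ^+ ((n + 9) * (2 * n + 1))
  / (n%:R / (2 * box_diam R n ^+ (2 * n + 4))) ^+ 2.

Definition off_tube_base (R : realType) (n : nat) : R :=
  2 ^+ (3 * (2 * n + 1) + 6).

Section OneStep.
Context {R : realType} {n : nat}.
Context (mu : {measure set (heis_borel R n) -> \bar R}).
Implicit Types p q c x w : heis R n.

Definition box_finite : Prop := forall (c : heis R n) (r : R),
  (mu (box c r) < +oo)%E.

(** [kernel_bound] is homogeneous of degree - (2n+1) in r. *)
Lemma kernel_boundE (eta r : R) : 0 < r ->
  kernel_bound n eta r * r ^+ (2 * n + 1) =
  n%:R / (2 * box_diam R n ^+ (2 * n + 4)) * eta ^+ 3.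
Proof.
move=> r0; rewrite /kernel_bound.
have : box_diam R n != 0 by rewrite gt_eqF// box_diam_gt0.
move: (box_diam R n) => K K0.
have r0' : r != 0 by rewrite gt_eqF.
rewrite !exprMn (_ : 2 * n + 4 = (2 * n + 1) + 3)%N; last by rewrite -addnA.
rewrite (exprD r (2 * n + 1) 3).
have : r ^+ (2 * n + 1) != 0 by rewrite expf_neq0.
have : K ^+ (2 * n + 1 + 3) != 0 by rewrite expf_neq0.
move: (r ^+ _) (K ^+ _) => rD KD KD0 rD0; field.
by rewrite KD0 r0' rD0.
Qed.

Lemma riesz_bounded_test (C : R) (A W : set (heis R n)) (delta c : R) :
  riesz_bounded mu C -> 0 < delta -> 0 <= c ->
  measurable (A : set (heis_borel R n)) ->
    measurable (W : set (heis_borel R n)) ->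
  (mu A < +oo)%E ->
  (forall p, W p -> c <= enorm (riesz_trunc mu delta \1_A p)) ->
  ((c ^+ 2)%:E * mu W <= (C ^+ 2)%:E * mu A)%E.
Proof.
move=> bdd d0 c0 mA mW fA h.
have L2 : memL2 mu (\1_A).
  split; first exact: measurable_indic.
  by rewrite /finite_norm Lnorm2_indic// poweR_lty.
have := bdd _ d0 _ L2 => b.
rewrite -(real_normK (num_real C)).
apply: (@Lnorm2_indic_test _ (heis_borel R n) R mu A W
  (fun p => enorm (riesz_trunc mu delta \1_A p)) c `|C|) => //.
  by move=> p; exact: enorm_ge0.
apply: (le_trans b); apply: lee_wpmul2r; first exact: Lnorm_ge0.
by rewrite lee_fin ler_norm.
Qed.

(** All horizontal coordinates, and the vertical coordinate in the chart of the
    box, are bisected l times. *)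
Lemma small_osc_piece x (r : R) (l : nat) :
  0 < r -> exists A, [/\ measurable (A : set (heis_borel R n)), A `<=` box x r,
    (mu (box x r) <= (2 ^+ (l * (2 * n + 1)))%:E * mu A)%E,
    (forall p q, A p -> A q -> forall j,
      `|p.1 0 j - q.1 0 j| <= 2 / 2 ^+ l * r) &
    (forall p q, A p -> A q -> `|vert x p - vert x q| <= 2 / 2 ^+ l * r ^+ 2)].
Proof.
move=> r0.
pose g (j : 'I_(n + n)) p : R := p.1 0 j - x.1 0 j.
have mg j : has_measurable_levels (g j : heis_borel R n -> R).
  apply: continuous_levels; apply: continuous_sub;
    [exact: continuous_coord|exact: continuous_cst].
have [A1 [mA1 A1B mu1 o1]] := pigeonhole_seq mu l (enum 'I_(n + n)) mg
  (measurable_box x r)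
  (fun j p (h : box x r p) => h.1 j).
have mv : has_measurable_levels (vert x : heis_borel R n -> R).
  by apply: continuous_levels; exact: continuous_vert.
have hA1 p : A1 p -> - r ^+ 2 <= vert x p <= - r ^+ 2 + 2 * r ^+ 2.
  move=> /A1B[_]; rewrite ler_norml => /andP[? ?]; apply/andP; split; lra.
have [A [mA AA1 mu2 o2]] := halving mu l mv mA1 hA1.
exists A; split=> //.
- exact: subset_trans A1B.
- apply: (le_trans mu1); rewrite size_enum_ord.
  have -> : (l * (2 * n + 1) = l * (n + n) + l)%N by lia.
  by rewrite exprD EFinM -muleA lee_pmul2l// lte_fin exprn_gt0.
- move=> p q Ap Aq j; have := o1 j; rewrite mem_enum =>
  /(_ isT p q (AA1 _ Ap) (AA1 _ Aq)).
  rewrite /g (_ : p.1 0 j - x.1 0 j - _ = p.1 0 j - q.1 0 j); last by ring.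
  by rewrite mulrAC.
- by move=> p q Ap Aq; rewrite mulrAC; exact: o2.
Qed.

(** The choice l = 3k+n+9 makes the oscillation of a piece small enough for
    [riesz_kernel_sign] with eta = 2^(-k). *)
Lemma osc_small (k : nat) (eta eps : R) : eta = 2 ^- k ->
  eps = 2 / 2 ^+ (3 * k + n + 9) ->
  [/\ 0 <= eps, eps <= eta / 2 & (72 * n%:R + 32) * eps <= eta ^+ 3 / 2].
Proof.
move=> -> -> {eta eps}.
have e1 : 1 <= 2 ^+ n :> R by rewrite exprn_ege1// ler1n.
have e2 : n%:R <= 2 ^+ n :> R by rewrite -natrX ler_nat ltnW// ltn_expl.
have e3 : 2 ^- k ^+ 3 = (2 ^+ (3 * k))^-1 :> R by rewrite mulnC exprM exprVn.
have e4 : 2 / 2 ^+ (3 * k + n + 9) = 2 ^- k ^+ 3 / (256 * 2 ^+ n) :> R.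
  rewrite e3 !exprD (_ : 2 ^+ 9 = 512); last by rewrite -natrX.
  have ? : 2 ^+ n != 0 :> R by rewrite expf_neq0.
  have ? : 2 ^+ (3 * k) != 0 :> R by rewrite expf_neq0.
  by field; apply/andP.
rewrite e4.
have k0 : 0 < 2 ^- k :> R by rewrite invr_gt0 exprn_gt0.
have k1 : 2 ^- k <= 1 :> R by rewrite invf_le1 ?exprn_gt0// exprn_ege1// ler1n.
move: k0 k1; set eta := 2 ^- k => k0 k1.
have n0 : 0 < 256 * 2 ^+ n :> R by rewrite mulr_gt0// exprn_gt0.
have eta3 : eta ^+ 3 <= eta.
  by rewrite exprS -[leRHS]mulr1 ler_wpM2l ?(ltW k0)// exprn_ile1// ltW.
have eta3' : 0 < eta ^+ 3 by rewrite exprn_gt0.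
split; first by rewrite divr_ge0 ?ltW.
- rewrite ler_pdivrMr//.
  by have : eta * 1 <= eta * 2 ^+ n; [rewrite ler_wpM2l// ltW|lra].
- rewrite mulrA ler_pdivrMr// (_ : eta ^+ 3 / 2 * _ = 128 * 2 ^+ n * eta ^+ 3);
  last by field.
  by rewrite ler_wpM2r ?(ltW eta3')//; lra.
Qed.

(** Let A be a piece of small oscillation and W the part of the box off the
    tube around a point of A.  The truncated transform of the indicator of A is
    at least c mu(A) on W, with c the lower bound for the kernel, so the L^2
    bound gives c^2 mu(A)^2 mu(W) <= C^2 mu(A); the density bounds mu(A) from
    below. *)
Lemma mass_off_tube (C : R) x (r Theta : R) (k : nat) : (0 < n)%N ->
  box_finite -> riesz_bounded mu C -> 0 < r -> 0 < Theta ->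
  ((Theta * r ^+ (2 * n + 1))%:E <= mu (box x r))%E ->
  exists2 q, box x r q &
    (mu (box x r `\` tube q (r / 2 ^+ k)) <=
     (off_tube_const n C * off_tube_base R n ^+ k * r ^+ (2 * n + 1) /
       Theta)%:E)%E.
Proof.
move=> n0 fin bdd r0 T0 dens.
set D := (2 * n + 1)%N in dens *.
pose l := (3 * k + n + 9)%N; pose eta : R := 2 ^- k; pose eps : R := 2 / 2 ^+ l.
have [eps0 eps2 epsn] := @osc_small k eta eps erefl erefl.
have eta0 : 0 < eta by rewrite invr_gt0 exprn_gt0.
have [A [mA AB muA oz ot]] := small_osc_piece x l r0.
have rD0 : 0 < r ^+ D by rewrite exprn_gt0.
have fA : (mu A < +oo)%E.
  by apply: le_lt_trans (fin x r); exact: le_measureW (measurable_box _ _) AB.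
have A0 : (0 < mu A)%E.
  rewrite ltNge; apply/negP => A0.
  have A00 : (mu A = 0)%E by apply/eqP; rewrite eq_le A0 measure_ge0.
  move: (le_trans dens muA); rewrite A00 mule0 lee_fin leNgt => /negP; apply.
  exact: mulr_gt0.
have [q Aq] : A !=set0.
  by apply/set0P/eqP => A00; move: A0; rewrite A00 measure0 ltxx.
exists q; first exact: AB.
set W := _ `\` _.
have mW : measurable (W : set (heis_borel R n)).
  apply: measurableD; first exact: measurable_box.
  by apply: measurable_closed; exact: closed_tube.
have fW : (mu W < +oo)%E.
  by apply: le_lt_trans (fin x r); apply: le_measureW => //;
    [exact: measurable_box|move=> ? []].
pose c := kernel_bound n eta r.
have c0 : 0 < c.
  rewrite /c /kernel_bound mulr_gt0 ?ltr0n// divr_gt0// ?mulr_gt0 ?exprn_gt0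
    ?mulr_gt0 ?box_diam_gt0//.
(* The truncation radius is below the distance eta r / 2 from A to W. *)
have test : (((c * fine (mu A)) ^+ 2)%:E * mu W <= (C ^+ 2)%:E * mu A)%E.
  have d0 : 0 < eta * r / 4 by rewrite divr_gt0// mulr_gt0.
  apply: (riesz_bounded_test bdd d0) => //.
    by rewrite mulr_ge0 ?(ltW c0)// fine_ge0.
  move=> p [hp]; rewrite [r / _]mulrC => npt.
  have [far [j [M sgn]]] := riesz_kernel_sign r0 eta0 eps0 eps2 epsn
     AB (AB _ Aq) hp npt
     (fun q' Aq' => oz _ _ Aq' Aq) (fun q' Aq' => ot _ _ Aq' Aq).
  apply: le_trans (coord_le_enorm _ j); rewrite /riesz_trunc mxE.
  apply: (@normr_Rintegral_ge_indic _ _ _ mu _ A _ c M) => //.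
  - by apply: measurableC; exact: measurable_hball.
  - move=> q' Aq'; rewrite /hball /setC /mkset => h.
    by have := le_trans (far _ Aq') h; have := mulr_gt0 eta0 r0; lra.
  - exact: ltW.
  - by case: sgn => h; [left|right] => q' Aq'; have := h _ Aq';
      rewrite indicE mem_set// mulr1.
  - by move=> q' nA; rewrite indicE memNset// mulr0.
have finA : mu A \is a fin_num by rewrite ge0_fin_numE.
have finW : mu W \is a fin_num by rewrite ge0_fin_numE.
have finB : mu (box x r) \is a fin_num by rewrite ge0_fin_numE.
move: test dens muA A0;
  rewrite -(fineK finW) -(fineK finA) -(fineK finB) -!EFinM !lee_fin lte_fin /=.
have : 0 <= fine (mu W) by rewrite fine_ge0.
move: (fine (mu A)) (fine (mu W)) (fine (mu (box x r))) =>
  a w b w0 test dens muA a0.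
have cr := kernel_boundE eta r0; rewrite -/c -/D in cr.
set c' := n%:R / _ in cr.
have c'0 : 0 < c' by rewrite /c' divr_gt0 ?ltr0n// mulr_gt0// exprn_gt0//
  box_diam_gt0.
rewrite /off_tube_const -/c' -/D.
have t1 : c ^+ 2 * a * w <= C ^+ 2.
  by rewrite -(ler_pM2r a0); apply: le_trans test; rewrite le_eqVlt; apply/orP;
    left; apply/eqP; ring.
(* What remains is arithmetic: the bound c^2 mu(A) mu(W) <= C^2 is combined with
   Theta r^D <= 2^(l D) mu(A). *)
rewrite ler_pdivlMr// -mulrA mulrAC [leRHS](_ : _ =
  C ^+ 2 * (2 ^+ ((n + 9) * D) * off_tube_base R n ^+ k * r ^+ D) / c' ^+ 2);
  last by ring.
rewrite ler_pdivlMr ?exprn_gt0//.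
have e6 : eta ^+ 6 * 2 ^+ (6 * k) = 1.
  by rewrite /eta exprVn -exprM [(k * 6)%N]mulnC mulVf// expf_neq0.
have lD : 2 ^+ (l * D) * 2 ^+ (6 * k) =
    2 ^+ ((n + 9) * D) * off_tube_base R n ^+ k.
  rewrite /off_tube_base -exprM -!exprD; congr (_ ^+ _); rewrite /l -/D.
  by clearbody D; ring.
rewrite -lD.
have s1 : Theta * r ^+ D <= 2 ^+ (l * D) * a by exact: le_trans muA.
have cc : (c * r ^+ D) ^+ 2 * 2 ^+ (6 * k) = c' ^+ 2.
  rewrite cr exprMn -exprM -mulrA e6 mulr1 //.
have s2 : c ^+ 2 * w * (Theta * r ^+ D) <= c ^+ 2 * w * (2 ^+ (l * D) * a).
  by rewrite ler_wpM2l// mulr_ge0// exprn_ge0// ltW.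
have s3 : c ^+ 2 * w * (Theta * r ^+ D) <= 2 ^+ (l * D) * C ^+ 2.
  apply: (le_trans s2);
    rewrite [leLHS](_ : _ = 2 ^+ (l * D) * (c ^+ 2 * a * w)); last by ring.
  by rewrite ler_wpM2l// exprn_ge0.
rewrite -cc [leLHS](_ : _ =
  c ^+ 2 * w * (Theta * r ^+ D) * (r ^+ D * 2 ^+ (6 * k))); last by ring.
rewrite [leRHS](_ : _ = 2 ^+ (l * D) * C ^+ 2 * (r ^+ D * 2 ^+ (6 * k)));
  last by ring.
by rewrite ler_wpM2r// mulr_ge0 ?exprn_ge0// ltW.
Qed.

Lemma one_step (C : R) x (r Theta : R) (k : nat) : (0 < n)%N ->
  box_finite -> riesz_bounded mu C -> 0 < r -> 0 < Theta ->
  ((Theta * r ^+ (2 * n + 1))%:E <= mu (box x r))%E ->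
  exists2 s, (size s = (n + 2) * 4 ^ k)%N &
    (mu (box x r `\` boxes s (r / 2 ^+ k)) <=
     (off_tube_const n C * off_tube_base R n ^+ k * r ^+ (2 * n + 1) /
       Theta)%:E)%E.
Proof.
move=> n0 fin bdd r0 T0 dens.
have [q hq hW] := mass_off_tube k n0 fin bdd r0 T0 dens.
have [s ss cov] := tube_cover k r0 hq.
exists s => //; apply: le_trans hW; apply: le_measureW.
- apply: measurableD; first exact: measurable_box.
  by apply: measurable_closed; exact: closed_boxes.
- apply: measurableD; first exact: measurable_box.
  by apply: measurable_closed; exact: closed_tube.
- by move=> p [hp nb]; split=> // ht; apply: nb; exact: cov.
Qed.

End OneStep.

(** * Hausdorff dimension from covers by boxes *)

Section Dimension.
Context {R : realType} {n : nat}.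
Implicit Types p q c x w : heis R n.
Local Notation hd := (@hdist R n).

Lemma expr_small (q A eps : R) : 0 <= q -> q < 1 -> 0 < eps ->
  exists N, forall j, (N <= j)%N -> A * q ^+ j <= eps.
Proof.
move=> q0 q1 e0.
have cq : (GRing.exp q : R^nat) @ \oo --> 0 by apply: cvg_expr;
  rewrite ger0_norm.
have c1 : 0 < eps / (`|A| + 1) by rewrite divr_gt0// ltr_wpDl.
have [N _ hN] : \forall j \near \oo, `|q ^+ j| <= eps / (`|A| + 1).
  exact: cvgr0_norm_le c1.
exists N => j Nj; have := hN j Nj; rewrite ger0_norm ?exprn_ge0// => h.
have A1 : 0 < `|A| + 1 by rewrite ltr_wpDl.
rewrite ler_pdivlMr// in h.
apply: le_trans h; rewrite mulrC ler_wpM2l ?exprn_ge0//.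
by have := ler_norm A; lra.
Qed.

Lemma ediam_box c (r : R) : 0 <= r ->
  (ediam hd (box c r) <= (box_diam R n * r)%:E)%E.
Proof.
move=> r0; apply: ge_ereal_sup => _ [[p q] [/= hp hq] <-].
by rewrite lee_fin; exact: (hdist_le_box r0 hq hp).
Qed.

Lemma diam_pow_box c (r s : R) : 0 <= r -> 0 <= s ->
  (diam_pow hd s (box c r) <= ((box_diam R n * r) `^ s)%:E)%E.
Proof.
move=> r0 s0; rewrite /diam_pow; case: eqP => [_|/eqP/set0P[y hy]].
  by rewrite lee_fin powR_ge0.
rewrite -poweR_EFin; apply: gt0_ler_poweR => //; last exact: ediam_box.
  rewrite in_itv /= leey andbT.
  apply: (@le_trans _ _ (hd y y)%:E); first by rewrite lee_fin knorm_ge0.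
  by apply: ereal_sup_ubound; exists (y, y).
by rewrite in_itv /= leey andbT lee_fin mulr_ge0// ltW// box_diam_gt0.
Qed.

Lemma diam_pow_ge0 (s : R) (E : set (heis R n)) : (0 <= diam_pow hd s E)%E.
Proof. by rewrite /diam_pow; case: ifP => // _; exact: poweR_ge0. Qed.

Lemma hausdorff_premeasure_ge0 (s delta : R) (E : set (heis R n)) :
  (0 <= hausdorff_premeasure hd s delta E)%E.
Proof.
apply: le_ereal_inf_tmp => _ [F _ <-].
by apply: nneseries_ge0 => i _ _; exact: diam_pow_ge0.
Qed.

Lemma hausdorff_premeasure_boxes (E : set (heis R n)) (L : seq (heis R n))
    (r s delta : R) :
  0 <= r -> 0 <= s -> box_diam R n * r <= delta -> E `<=` boxes L r ->
  (hausdorff_premeasure hd s delta E <=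
   ((size L)%:R * (box_diam R n * r) `^ s)%:E)%E.
Proof.
move=> r0 s0 rd EL.
pose F i := if (i < size L)%N then box (nth (0 : heis R n) L i) r else set0.
apply: ge_ereal_inf; exists (\sum_(0 <= i <oo) diam_pow hd s (F i))%E.
  exists F => //; split.
    move=> p /EL[c cL hc]; exists (index c L) => //.
    by rewrite /F index_mem cL nth_index.
  move=> i; rewrite /F; case: ifP => _.
    by apply: le_trans (ediam_box _ r0) _; rewrite lee_fin.
  apply: ge_ereal_sup => _ [[p q] [/= []] ].
rewrite (nneseries_split 0 (size L)); last by move=> k _; exact: diam_pow_ge0.
rewrite add0n [X in (_ + X)%E]eseries0 ?adde0; last first.
  by move=> i Li _; rewrite /F ltnNge Li /= /diam_pow eqxx.
apply: (@le_trans _ _ (\sum_(0 <= i < size L) ((box_diam R n * r) `^ s)%:E)%E).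
  rewrite !big_nat; apply: lee_sum => i /andP[_ iL].
  by rewrite /F iL; exact: diam_pow_box.
by rewrite sumEFin sumr_const_nat subn0 mulr_natl.
Qed.

Lemma hausdorff_dim_le (E : set (heis R n)) (s0 : R) : 0 <= s0 ->
  (forall e eps : R, 0 < e -> 0 < eps -> exists L r,
    [/\ 0 <= r, box_diam R n * r <= eps, E `<=` boxes L r &
      (size L)%:R * (box_diam R n * r) `^ (s0 + e) <= eps]) ->
  (hausdorff_dim hd E <= s0%:E)%E.
Proof.
move=> s00 h; apply/lee_addgt0Pr => e e0.
apply: ereal_inf_lbound; exists (s0 + e) => //.
have se0 : 0 <= s0 + e by rewrite addr_ge0// ltW.
split=> //; apply/eqP; rewrite eq_le; apply/andP; split.
  apply: ge_ereal_sup => _ [delta /= d0 <-]; apply/lee_addgt0Pr => eps eps0.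
  have m0 : 0 < Num.min delta eps by rewrite lt_min d0.
  have [L [r [r0 r1 EL sL]]] := h _ _ e0 m0.
  rewrite add0e.
  apply: (le_trans (hausdorff_premeasure_boxes r0 se0 _ EL)).
    by rewrite (le_trans r1)// ge_min lexx.
  by rewrite lee_fin (le_trans sL)// ge_min lexx orbT.
apply: (@le_trans _ _ (hausdorff_premeasure hd (s0 + e) 1 E)).
  exact: hausdorff_premeasure_ge0.
by apply: ereal_sup_ubound; exists 1 => //=.
Qed.

(** With N boxes of radius rho = r 2^(-j^2), N rho^(2+e) is at most a constant
    times ((n+2) 2^(-e j))^j, which tends to 0 for every e > 0. *)
Lemma fast_cover_dim_le2 (E : set (heis R n)) (r : R)
    (L : nat -> seq (heis R n)) :
  0 < r -> (forall j, E `<=` boxes (L j) (r / 2 ^+ (j ^ 2))) ->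
  (forall j, (size (L j) <= (n + 2) ^ j * 4 ^ (j ^ 2))%N) ->
  (hausdorff_dim hd E <= 2%:E)%E.
Proof.
move=> r0 EL sL; apply: hausdorff_dim_le => // e eps e0 eps0.
set K := box_diam R n * r.
have K0 : 0 < K by rewrite mulr_gt0// box_diam_gt0.
pose q : R := 2 `^ (- e).
have q0 : 0 <= q by exact: powR_ge0.
have q1 : q < 1.
  rewrite /q powRN invf_lt1 ?powR_gt0//.
  have : 1 `^ e < 2 `^ e by apply: gt0_ltr_powR => //; rewrite ?nnegrE// ltr1n.
  by rewrite powR1.
have h12 : 2^-1 < 1 :> R by lra.
have h02 : 0 <= 2^-1 :> R by [].
have [N1 h1] := expr_small K h02 h12 eps0.
have [N2 h2] := expr_small (K `^ (2 + e)) h02 h12 eps0.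
have [N3 h3] := expr_small (n + 2)%:R q0 q1 (ltac:(lra) : 0 < 2^-1 :> R).
(* The boxes are small from N1 on; from N3 on their total contribution is at
   most K^(2+e) 2^(-j), which is small from N2 on. *)
pose j := (N1 + N2 + N3)%N.
exists (L j), (r / 2 ^+ (j ^ 2)); split=> //.
- by rewrite divr_ge0 ?exprn_ge0// ltW.
- have N1j : (N1 <= j)%N by rewrite /j -addnA leq_addr.
  apply: le_trans (h1 _ N1j); rewrite mulrA -/K exprVn ler_wpM2l// ?(ltW K0)//.
  rewrite lef_pV2 ?posrE ?exprn_gt0// ler_eXn2l ?ltr1n//.
  by rewrite -[leqLHS]expn1; case: j {N1j} => // j; rewrite leq_pexp2l.
have N2j : (N2 <= j)%N by rewrite /j -addnA addnCA leq_addr.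
have N3j : (N3 <= j)%N by rewrite /j leq_addl.
apply: le_trans (h2 _ N2j); rewrite mulrA -/K.
set m := (j ^ 2)%N.
have -> : (K / 2 ^+ m) `^ (2 + e) = K `^ (2 + e) * ((4 ^+ m)^-1 * q ^+ m).
  have t0 : 0 <= (2 ^+ m)^-1 :> R by rewrite invr_ge0 exprn_ge0.
  rewrite powRM ?(ltW K0)//; congr (_ * _).
  have -> : (2 ^+ m)^-1 = 2 `^ (- m%:R) :> R by rewrite powRN powR_mulrn.
  rewrite -powRrM (_ : - m%:R * (2 + e) = - (2 * m)%:R + - e * m%:R);
    last by rewrite natrM; ring.
  rewrite powRD; last by rewrite pnatr_eq0 implybT.
  rewrite powRN powR_mulrn// exprM -natrX; congr (_ * _).
  by rewrite powRrM powR_mulrn.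
have mE : m = (j * j)%N by [].
have e1 : (size (L j))%:R <= ((n + 2)%:R ^+ j * 4 ^+ m) :> R.
  by rewrite -!natrX -natrM ler_nat.
have g0 : 0 <= K `^ (2 + e) * ((4 ^+ m)^-1 * q ^+ m).
  by rewrite !mulr_ge0 ?powR_ge0 ?invr_ge0 ?exprn_ge0.
apply: (le_trans (ler_wpM2r g0 e1)).
rewrite [leLHS](_ : _ = K `^ (2 + e) * ((n + 2)%:R * q ^+ j) ^+ j); last first.
  have ? : 4 ^+ m != 0 :> R by rewrite expf_neq0.
  by rewrite exprMn -exprM -mE; field.
rewrite ler_wpM2l ?powR_ge0// lerXn2r ?nnegrE ?mulr_ge0 ?exprn_ge0//.
exact: h3.
Qed.

End Dimension.

(** * Iteration over all scales *)

(** Chosen so that [4 ^+ decay_exponent n] bounds the base of the geometric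
    growth in [superexponential_decay]. *)
Definition decay_exponent (n : nat) : nat :=
  (2 + 2 * (n + 2) + 2 * (6 * n + 9))%N.

(** The constant C2 of the theorem. *)
Definition critical_density (R : realType) (n : nat) (C : R) : R :=
  1 + 4 * off_tube_const n C * off_tube_base R n * 4 ^+ (decay_exponent n ^ 2).

(** The mass threshold at generation j when the initial box has mass M.  Since
    there are at most (n+2)^j 4^(j^2) boxes, all boxes below the threshold
    carry together at most M 4^(-j). *)
Definition heavy_mass (R : realType) (n : nat) (M : R) (j : nat) : R :=
  M / (4 ^+ (j ^ 2) * (4 * (n + 2)%:R) ^+ j).

Definition generation_radius (R : realType) (r : R) (j : nat) : R :=
  r / 2 ^+ (j ^ 2).

(** A bound for the mass lost from one box of generation j: the first summand
    is the mass off the tube, the second one the mass of the light children. *)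
Definition box_loss (R : realType) (n : nat) (C M r : R) (j : nat) : R :=
  off_tube_const n C * off_tube_base R n ^+ (2 * j + 1)
    * generation_radius r j ^+ (2 * n + 1)
    / (heavy_mass n M j / generation_radius r j ^+ (2 * n + 1))
  + ((n + 2) * 4 ^ (2 * j + 1))%:R * heavy_mass n M j.+1.

Section Iteration.
Context {R : realType} {n : nat}.
Context (mu : {measure set (heis_borel R n) -> \bar R}).
Implicit Types p q c x w : heis R n.

Lemma measurable_boxes (s : seq (heis R n)) r :
  measurable (boxes s r : set (heis_borel R n)).
Proof. by apply: measurable_closed; exact: closed_boxes. Qed.

Lemma measure_boxes_le (s : seq (heis R n)) (r m : R) :
  (forall c, c \in s -> (mu (box c r) <= m%:E)%E) ->
  (mu (boxes s r) <= ((size s)%:R * m)%:E)%E.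
Proof.
move=> h.
have := @measure_seq_cover _ _ _ mu _ (fun c => box c r) s (boxes s r)
  (fun c => measurable_box c r) (measurable_boxes s r) (fun p hp => hp).
move=> /le_trans; apply.
apply: (@le_trans _ _ (\sum_(c <- s) m%:E)%E).
  by rewrite !big_seq; apply: lee_sum => c; exact: h.
by rewrite sumEFin big_const_seq count_predT iter_addr_0 mulr_natl.
Qed.

(** The children are the boxes covering the tube, of which those of mass less
    than m are discarded. *)
Lemma heavy_children (C : R) x (r Theta m : R) (k : nat) : (0 < n)%N ->
  box_finite mu -> riesz_bounded mu C -> 0 < r -> 0 < Theta -> 0 <= m ->
  ((Theta * r ^+ (2 * n + 1))%:E <= mu (box x r))%E ->
  exists s, [/\ (size s <= (n + 2) * 4 ^ k)%N,
    forall c, c \in s -> (m%:E <= mu (box c (r / 2 ^+ k)))%E &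
    (mu (box x r `\` boxes s (r / 2 ^+ k)) <=
     (off_tube_const n C * off_tube_base R n ^+ k * r ^+ (2 * n + 1) / Theta
      + ((n + 2) * 4 ^ k)%:R * m)%:E)%E].
Proof.
move=> n0 fin bdd r0 T0 m0 dens.
have [s ss hs] := one_step k n0 fin bdd r0 T0 dens.
pose heavy c := (m%:E <= mu (box c (r / 2 ^+ k)))%E.
exists (seq.filter heavy s); split.
- by rewrite -ss size_filter count_size.
- by move=> c; rewrite mem_filter => /andP[].
rewrite EFinD.
have light : (mu (boxes (seq.filter (predC heavy) s) (r / 2 ^+ k)) <=
    (((n + 2) * 4 ^ k)%:R * m)%:E)%E.
  apply: (le_trans (@measure_boxes_le _ _ m _)).
    by move=> c; rewrite mem_filter /heavy /= -ltNge => /andP[/ltW].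
  by rewrite lee_fin ler_wpM2r// ler_nat -ss size_filter count_size.
apply: le_trans (leeD hs light).
apply: measure_le2.
- by apply: measurableD; [exact: measurable_box|exact: measurable_boxes].
- by apply: measurableD; [exact: measurable_box|exact: measurable_boxes].
- exact: measurable_boxes.
move=> p [hp np]; have [[c cs hc]|h] := pselect (boxes s (r / 2 ^+ k) p);
  last by left.
right; exists c => //; rewrite mem_filter cs andbT /=; apply/negP => hv.
by apply: np; exists c => //; rewrite mem_filter hv.
Qed.

Lemma off_tube_const_ge0 (C : R) : 0 <= off_tube_const n C.
Proof.
by rewrite /off_tube_const divr_ge0 ?sqr_ge0// mulr_ge0 ?sqr_ge0// exprn_ge0.
Qed.

Lemma off_tube_base_gt0 : 0 < off_tube_base R n :> R.
Proof. by rewrite exprn_gt0. Qed.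

Lemma critical_density_ge1 (C : R) : 1 <= critical_density n C.
Proof.
rewrite lerDl; apply: mulr_ge0; last exact: exprn_ge0.
by apply: mulr_ge0; [rewrite mulr_ge0 ?off_tube_const_ge0|exact: ltW
  off_tube_base_gt0].
Qed.

(** The left side is at most 4^(g j - j^2) with g = [decay_exponent n]. *)
Lemma superexponential_decay (j : nat) :
  (16 * (n + 2)%:R ^+ 2 * off_tube_base R n ^+ 2) ^+ j / 4 ^+ (j ^ 2)
    <= 4 ^+ (decay_exponent n ^ 2) :> R.
Proof.
have n2 : (n + 2)%:R <= 4 ^+ (n + 2) :> R by rewrite -natrX ler_nat ltnW//
  ltn_expl.
have b2 : off_tube_base R n <= 4 ^+ (6 * n + 9) :> R.
  rewrite /off_tube_base (_ : 3 * (2 * n + 1) + 6 = 6 * n + 9)%N; last by lia.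
  by rewrite lerXn2r ?nnegrE//; lra.
have G : 16 * (n + 2)%:R ^+ 2 * off_tube_base R n ^+ 2 <= 4 ^+ decay_exponent n
  :> R.
  have -> : 4 ^+ decay_exponent n = 16 * (4 ^+ (n + 2)) ^+ 2 * (4 ^+ (6 * n +
    9)) ^+ 2 :> R.
    have -> : (decay_exponent n = 2 + (n + 2) * 2 + (6 * n + 9) * 2)%N by
      rewrite /decay_exponent; lia.
    rewrite (exprD 4 (2 + (n + 2) * 2)) (exprD 4 2) -!exprM.
    by rewrite (_ : 4 ^+ 2 = 16 :> R); [|rewrite -natrX].
  apply: ler_pM; rewrite ?mulr_ge0 ?exprn_ge0// ?(ltW off_tube_base_gt0)//.
    by rewrite ler_wpM2l// lerXn2r ?nnegrE ?exprn_ge0.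
  by rewrite lerXn2r ?nnegrE ?exprn_ge0// ltW// off_tube_base_gt0.
rewrite ler_pdivrMr ?exprn_gt0//.
apply: (@le_trans _ _ (4 ^+ decay_exponent n ^+ j)).
  by rewrite lerXn2r ?nnegrE ?exprn_ge0// !mulr_ge0 ?exprn_ge0// ltW//
    off_tube_base_gt0.
rewrite -exprM -exprD ler_eXn2l ?ltr1n//.
by move: (decay_exponent n) => g; nia.
Qed.

(** Both kinds of losses are at most M 4^(-j-1).  For the light children this
    is the choice of [heavy_mass].  For the mass off the tubes, the bound per
    box is inversely proportional to the density of the box, and
    rho^(2D) <= r^(2D) 4^(-3 j^2) with rho = r 2^(-j^2) and D = 2n+1 >= 3
    leaves a factor 4^(-j^2) that absorbs all exponential factors in j. *)
Lemma generation_loss (C M r : R) (j : nat) : (0 < n)%N -> 0 < r ->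
  M = critical_density n C * r ^+ (2 * n + 1) ->
  ((n + 2) ^ j * 4 ^ (j ^ 2))%:R * box_loss n C M r j <= M / (2 ^ j.+1)%:R.
Proof.
move=> n0 r0 ME; rewrite /box_loss /generation_radius.
set rj := r / _; set D := (2 * n + 1)%N in ME *.
set H := off_tube_const n C; set b : R := off_tube_base R n;
  set T := critical_density n C in ME *.
set N : R := (n + 2)%:R.
have H0 : 0 <= H by exact: off_tube_const_ge0.
have b0 : 0 < b := off_tube_base_gt0.
have T1 : 1 <= T by exact: critical_density_ge1.
have T0 : 0 < T by lra.
have N0 : 0 < N by rewrite ltr0n addn_gt0 orbT.
have rD0 : 0 < r ^+ D by rewrite exprn_gt0.
have M0 : 0 < M by rewrite ME mulr_gt0.
have q0 : 0 < 4 ^+ (j ^ 2) :> R by rewrite exprn_gt0.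
have Nj0 : 0 < N ^+ j by rewrite exprn_gt0.
have fj0 : 0 < 4 ^+ j :> R by rewrite exprn_gt0.
have light : ((n + 2) ^ j * 4 ^ (j ^ 2))%:R *
    (((n + 2) * 4 ^ (2 * j + 1))%:R * heavy_mass n M j.+1) = M / 4 ^+ j.+1.
  rewrite /heavy_mass (_ : j.+1 ^ 2 = j ^ 2 + (2 * j + 1))%N; last by lia.
  rewrite !natrM !natrX (exprD 4 (j ^ 2)) -/N exprMn !(exprS _ j).
  have simp (a b' c e f : R) : a != 0 -> b' != 0 -> c != 0 -> e != 0 ->
    f != 0 ->
      a * b' * (f * c * (M / (b' * c * (4 * e * (f * a))))) = M / (4 * e).
    by move=> *; field; do !(apply/andP; split).
  by apply: simp; rewrite ?expf_neq0// gt_eqF.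
have off : ((n + 2) ^ j * 4 ^ (j ^ 2))%:R *
   (H * b ^+ (2 * j + 1) * rj ^+ D / (heavy_mass n M j / rj ^+ D))
   <= M / 4 ^+ j.+1.
  (* This uses 2n+1 >= 3, that is, n >= 1. *)
  have rj2 : rj ^+ D * rj ^+ D <= r ^+ D * r ^+ D / (4 ^+ (j ^ 2)) ^+ 3.
    rewrite -!expr2 -!exprM /rj expr_div_n -exprM.
    rewrite ler_wpM2l ?exprn_ge0// ?(ltW r0)// lef_pV2 ?posrE ?exprn_gt0//.
    rewrite (_ : 4 = 2 ^+ 2 :> R); last by rewrite -natrX.
    rewrite -!exprM ler_eXn2l ?ltr1n//.
    by rewrite mulnCA leq_mul2l mulnC; apply/orP; right; rewrite /D; nia.
  have -> : ((n + 2) ^ j * 4 ^ (j ^ 2))%:R *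
   (H * b ^+ (2 * j + 1) * rj ^+ D / (heavy_mass n M j / rj ^+ D)) =
    N ^+ j * 4 ^+ (j ^ 2) * (H * b ^+ (2 * j + 1) *
      (4 ^+ (j ^ 2) * (4 * N) ^+ j) / M) * (rj ^+ D * rj ^+ D).
    rewrite !natrM !natrX -/N /heavy_mass exprMn.
    have ? : rj ^+ D != 0 by rewrite expf_neq0// mulf_neq0 ?gt_eqF// invr_gt0
      exprn_gt0.
    field.
    by rewrite !gt_eqF.
  apply: (le_trans (ler_wpM2l _ rj2)).
    have N40 : 0 <= 4 * N by lra.
    apply: mulr_ge0; first exact: mulr_ge0 (ltW Nj0) (ltW q0).
    apply: divr_ge0 (ltW M0); apply: mulr_ge0.
      exact: mulr_ge0 H0 (exprn_ge0 _ (ltW b0)).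
    exact: mulr_ge0 (ltW q0) (exprn_ge0 _ N40).
  have sd := superexponential_decay j; rewrite -/b -/N in sd.
  have -> : N ^+ j * 4 ^+ (j ^ 2) * (H * b ^+ (2 * j + 1) *
      (4 ^+ (j ^ 2) * (4 * N) ^+ j) / M) * (r ^+ D * r ^+ D / (4 ^+ (j ^ 2)) ^+
        3) =
    r ^+ D / T / 4 ^+ j.+1 * (4 * H * b * ((16 * N ^+ 2 * b ^+ 2) ^+ j / 4 ^+
      (j ^ 2))).
    rewrite ME (exprD b) (exprM b) expr1 !exprMn (exprS _ j) (_ : 16 = 4 * 4 :>
      R); last by rewrite -natrM.
    rewrite (exprMn j 4 4).
    have simp (a q' h B v f d t : R) : q' != 0 -> f != 0 -> d != 0 -> t != 0 ->
        a * q' * (h * (B * B * v) * (q' * (f * a)) / (t * d)) * (d * d / q' ^+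
          3) =
        d / t / (4 * f) * (4 * h * v * (f * f * (a * a) * (B * B) / q')).
      by move=> *; field; do !(apply/andP; split).
    by apply: simp; rewrite gt_eqF.
  have TT : 4 * H * b * 4 ^+ (decay_exponent n ^ 2) <= T * T.
    have : 4 * H * b * 4 ^+ (decay_exponent n ^ 2) <= T by rewrite /T
      /critical_density -/H -/b; lra.
    by move=> /le_trans; apply; rewrite ler_peMr// ltW.
  rewrite [leRHS](_ : _ = r ^+ D / T / 4 ^+ j.+1 * (T * T)); last first.
    by rewrite ME; have ? : 4 ^+ j.+1 != 0 :> R by [rewrite expf_neq0]; field;
      rewrite !gt_eqF.
  apply: ler_wpM2l; first by rewrite !mulr_ge0 ?invr_ge0 ?exprn_ge0// ltW.
  apply: le_trans TT; apply: ler_wpM2l => //.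
  by apply: mulr_ge0 (ltW b0); apply: mulr_ge0.
rewrite mulrDr light; apply: (le_trans (lerD off (lexx _))).
rewrite -mulrDl [leRHS](_ : _ = (M + M) / (2 * (2 ^ j.+1)%:R)); last first.
  have ? : (2 ^ j.+1)%:R != 0 :> R by rewrite pnatr_eq0 expn_eq0.
  by field.
rewrite ler_wpM2l ?addr_ge0 ?(ltW M0)// lef_pV2 ?posrE ?exprn_gt0// ?mulr_gt0
  ?ltr0n ?expn_gt0//.
rewrite -natrX -natrM ler_nat -expnS.
by rewrite -[4%N]/(2 ^ 2)%N -expnM leq_exp2l//; lia.
Qed.

(** If the density of the box exceeded the critical one, the intersection of
    all generations of heavy boxes would be a closed set of dimension at most 2
    and of positive measure. *)
Lemma density_bound (C : R) x (r : R) : (0 < n)%N ->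
  box_finite mu -> riesz_bounded mu C ->
  (forall F : set (heis_borel R n), measurable F ->
     (hausdorff_dim (@hdist R n) F <= 2%:E)%E -> mu F = 0%E) ->
  0 < r ->
  (mu (box x r) <= (critical_density n C * r ^+ (2 * n + 1))%:E)%E.
Proof.
move=> n0 fin bdd null r0; set M := critical_density n C * _.
have M0 : 0 < M by rewrite mulr_gt0 ?exprn_gt0// (lt_le_trans _
  (critical_density_ge1 C)).
rewrite leNgt; apply/negP => big.
pose rad := generation_radius r.
have rad0 j : 0 < rad j by rewrite divr_gt0// exprn_gt0.
have hm0 j : 0 < heavy_mass n M j.
  by rewrite divr_gt0// mulr_gt0 ?exprn_gt0// mulr_gt0// ltr0n addn_gt0 orbT.
have radS j : rad j.+1 = rad j / 2 ^+ (2 * j + 1).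
  by rewrite /rad /generation_radius (_ : j.+1 ^ 2 = j ^ 2 + (2 * j + 1))%N;
    [rewrite exprD invfM mulrA|lia].
pose loss := box_loss n C M r.
(* Light boxes, which never occur below, are given no children so that a
   choice of children can be made for all centres at once. *)
have children (jc : nat * heis R n) : exists s,
  ((heavy_mass n M jc.1)%:E <= mu (box jc.2 (rad jc.1)))%E ->
    [/\ (size s <= (n + 2) * 4 ^ (2 * jc.1 + 1))%N,
      forall c, c \in s -> ((heavy_mass n M jc.1.+1)%:E <= mu (box c (rad
        jc.1.+1)))%E &
      (mu (box jc.2 (rad jc.1) `\` boxes s (rad jc.1.+1)) <= (loss jc.1)%:E)%E].
  case: jc => j c /=; have [hv|hv] := pselect ((heavy_mass n M j)%:E <= mu (box
    c (rad j)))%E; last by exists [::].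
  have rD : 0 < rad j ^+ (2 * n + 1) by rewrite exprn_gt0.
  have hv' : ((heavy_mass n M j / rad j ^+ (2 * n + 1) * rad j ^+ (2 * n +
    1))%:E <= mu (box c (rad j)))%E.
    by rewrite divfK// gt_eqF.
  have [s [s1 s2 s3]] := heavy_children (2 * j + 1) n0 fin bdd (rad0 j)
    (divr_gt0 (hm0 j) rD)
     (ltW (hm0 j.+1)) hv'.
  by exists s => _; rewrite radS.
have [ch hch] := choice children.
(* The centres of the boxes of generation j. *)
pose L := fix L j := if j is j'.+1 then flatten [seq ch (j',
  c) | c <- L j'] else [:: x].
have Lheavy j c : c \in L j -> ((heavy_mass n M j)%:E <= mu (box c (rad j)))%E.
  elim: j c => [|j IH] c /=.
    rewrite inE => /eqP ->;
      rewrite /heavy_mass /rad /generation_radius !expr0 mul1r !divr1.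
    exact: ltW.
  by move=> /flatten_mapP[c' c'L]; have [_ h _] := hch (j, c') (IH _ c'L);
    exact: h.
have Lsize j : (size (L j) <= (n + 2) ^ j * 4 ^ (j ^ 2))%N.
  elim: j => // j IH /=.
  rewrite size_flatten /shape -map_comp sumnE big_map.
  apply: (@leq_trans (\sum_(c <- L j) (n + 2) * 4 ^ (2 * j + 1))).
    rewrite !big_seq; apply: leq_sum => c cL.
    by have [h _ _] := hch (j, c) (Lheavy _ _ cL).
  rewrite big_const_seq count_predT iter_addn_0 mulnC.
  apply: (leq_trans (leq_mul IH (leqnn _))).
  rewrite (_ : j.+1 ^ 2 = j ^ 2 + (2 * j + 1))%N; last by lia.
  by rewrite (expnS (n + 2) j) (expnD 4 (j ^ 2)) mulnACA [((n + 2) ^ j *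
    _)%N]mulnC.
pose U j := boxes (L j) (rad j).
have mU j : measurable (U j : set (heis_borel R n)) by exact: measurable_boxes.
pose E := \bigcap_j U j.
have cE : closed E by apply: closed_bigI => j _; exact: closed_boxes.
have mE : measurable (E : set (heis_borel R n)) by exact: measurable_closed.
have E0 : mu E = 0%E.
  apply: null => //; apply: (fast_cover_dim_le2 r0 _ Lsize).
  by move=> j p; apply.
have mUU j : measurable (U j `\` U j.+1 : set (heis_borel R n)) by exact:
  measurableD.
have lossU j : (mu (U j `\` U j.+1) <= (M / (2 ^ j.+1)%:R)%:E)%E.
  have l0 : 0 <= loss j.
    apply: addr_ge0; last by rewrite mulr_ge0// ltW.
    apply: mulr_ge0; last by rewrite invr_ge0 divr_ge0 ?exprn_ge0 ?(ltW (hm0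
      j)) ?(ltW (rad0 j)).
    apply: mulr_ge0; last by rewrite exprn_ge0 ?(ltW (rad0 j)).
    by apply: mulr_ge0; [exact: off_tube_const_ge0|rewrite exprn_ge0// ltW//
      off_tube_base_gt0].
  apply: (@le_trans _ _ (\sum_(c <- L j) mu (box c (rad j) `\` U j.+1))%E).
    apply: measure_seq_cover => //.
      by move=> c; apply: measurableD => //; exact: measurable_box.
    by move=> p [[c cL hc] nU]; exists c.
  apply: (@le_trans _ _ (\sum_(c <- L j) (loss j)%:E)%E).
    rewrite !big_seq; apply: lee_sum => c cL.
    have [_ _ h] := hch (j, c) (Lheavy _ _ cL); apply: le_trans h.
    apply: le_measureW.
    - by apply: measurableD => //; exact: measurable_box.
    - by apply: measurableD; [exact: measurable_box|exact: measurable_boxes].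
    - move=> p [hp nU]; split=> // -[c' c's hc']; apply: nU; exists c' => //.
      by apply/flatten_mapP; exists c.
  rewrite sumEFin big_const_seq count_predT iter_addr_0 -[(loss j *+
    _)%R]mulr_natl lee_fin.
  apply: le_trans (generation_loss j n0 r0 erefl).
  by rewrite ler_wpM2r// ler_nat.
have tot : (mu (\bigcup_j (U j `\` U j.+1)) <= M%:E)%E.
  apply: le_trans (@epsilon_trick0 R M xpredT (ltW M0)).
  apply: (@le_trans _ _ (\sum_(j <oo) mu (U j `\` U j.+1))%E).
    by apply: measure_sigma_subadditive => //; exact: bigcup_measurable.
  by apply: lee_nneseries => // j _.
(* A point that does not survive is lost at some generation. *)
have cover : box x r `<=` E `|` \bigcup_j (U j `\` U j.+1).
  move=> p hp; have [Ep|nE] := pselect (E p); first by left.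
  right; apply: contrapT => nU; apply: nE => j _.
  elim: j => [|j IH].
    by exists x; [rewrite /= mem_head|rewrite /rad /generation_radius expr0
      divr1].
  by apply: contrapT => nj; apply: nU; exists j.
have := measure_le2 mu (measurable_box x r) mE (bigcup_measurable (fun j _ =>
  mUU j)) cover.
rewrite E0 add0e => /le_trans /(_ tot); rewrite leNgt => /negP; exact.
Qed.

End Iteration.

Theorem theorem1p1 (R : realType) (n : nat) (hn : (1 <= n)%N) (C1 : R) :
  exists C2 : R,
    forall mu : {measure set (heis_borel R n) -> \bar R},
      radon mu ->
      riesz_bounded mu C1 ->
      (forall F : set (heis_borel R n), measurable F ->
         (hausdorff_dim (@hdist R n) F <= 2%:E)%E -> mu F = 0%E) ->
      forall (x : heis R n) (r : R), 0 < r ->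
        (mu (hball x r) <= (C2 * r ^+ (2 * n + 1))%:E)%E.
Proof.
exists (critical_density n C1) => mu [fin _ _] bdd null x r r0.
apply: (@le_trans _ _ (mu (box x r))).
  by apply: le_measureW;
    [exact: measurable_hball|exact: measurable_box|exact: hball_sub_box].
apply: density_bound => // c s.
by apply: fin; exact: compact_box.
Qed.
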